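(* Let $\ell=\max_{k\le K}\ell_k$ with measurable $\ell_k:\mathbb{R}^m\to\overline{\mathbb{R}}$. Assume that $\Xi\subseteq\mathbb{R}^m$ is convex and closed, that $-\ell_k$ is proper, convex and lower semicontinuous for all $k\le K$, and that $\ell_k$ is not identically $-\infty$ on $\Xi$ for all $k\le K$. Then for any $\varepsilon\ge0$ the worst-case expectation $$\sup_{\mathbb{Q}\in\mathbb{B}_\varepsilon(\widehat{\mathbb{P}}_N)}\mathbb{E}^{\mathbb{Q}}[\ell(\xi)]$$ equals the optimal value of the finite convex program $$\begin{array}{cll}\inf\limits_{\lambda,s_i,z_{ik},\nu_{ik}}&\lambda\varepsilon+\frac1N\sum\limits_{i=1}^Ns_i&\\ \text{s.t.}&[-\ell_k]^*(z_{ik}-\nu_{ik})+\sigma_\Xi(\nu_{ik})-\langle z_{ik},\widehat\xi_i\rangle\le s_i&\forall i\le N,\ \forall k\le K\\ &\|z_{ik}\|_*\le\lambda&\forall i\le N,\ \forall k\le K,\end{array}$$ where $\lambda,s_i\in\mathbb{R}$ and $z_{ik},\nu_{ik}\in\mathbb{R}^m$.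
   Context: Notation: $\overline{\mathbb{R}}=\mathbb{R}\cup\{-\infty,\infty\}$; $\langle a,b\rangle=a^\top b$; $\|\cdot\|$ is an arbitrary norm on $\mathbb{R}^m$ with dual norm $\|z\|_*=\sup_{\|\xi\|\le1}\langle z,\xi\rangle$. A function $f:\mathbb{R}^m\to\overline{\mathbb{R}}$ is proper if $f(\xi)<+\infty$ for at least one $\xi$ and $f(\xi)>-\infty$ for all $\xi$. Conjugate: $f^*(z)=\sup_{\xi\in\mathbb{R}^m}\langle z,\xi\rangle-f(\xi)$. Support function: $\sigma_\Xi(z)=\sup_{\xi\in\Xi}\langle z,\xi\rangle$. Conventions of extended arithmetic: $\infty\cdot0=0\cdot\infty=0/0=0$ and $\infty-\infty=-\infty+\infty=1/0=\infty$. Expectations are $\mathbb{E}^{\mathbb{Q}}[\ell(\xi)]=\mathbb{E}^{\mathbb{Q}}[\max\{\ell(\xi),0\}]+\mathbb{E}^{\mathbb{Q}}[\min\{\ell(\xi),0\}]$ under these conventions. Data and ball: $\widehat\xi_1,\dots,\widehat\xi_N\in\Xi$ are given points and $\widehat{\mathbb{P}}_N=\frac1N\sum_{i=1}^N\delta_{\widehat\xi_i}$. $\mathcal{M}(\Xi)$ is the set of probability distributions $\mathbb{Q}$ supported on $\Xi$ with $\mathbb{E}^{\mathbb{Q}}[\|\xi\|]<\infty$; $d_{\mathrm W}(\mathbb{Q}_1,\mathbb{Q}_2)=\inf_\Pi\int_{\Xi^2}\|\xi_1-\xi_2\|\,\Pi(d\xi_1,d\xi_2)$ over joint distributions $\Pi$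 with marginals $\mathbb{Q}_1,\mathbb{Q}_2$; $\mathbb{B}_\varepsilon(\widehat{\mathbb{P}}_N)=\{\mathbb{Q}\in\mathcal{M}(\Xi):d_{\mathrm W}(\widehat{\mathbb{P}}_N,\mathbb{Q})\le\varepsilon\}$. *)

(* Defs.v *)
From HB Require Import structures.
From mathcomp Require Import all_boot all_order all_algebra.
From mathcomp Require Import all_classical all_reals all_analysis measurable_realfun.

Set Implicit Arguments.
Unset Strict Implicit.
Unset Printing Implicit Defensive.

Import Order.TTheory GRing.Theory Num.Theory.
Import numFieldNormedType.Exports.

Local Open Scope classical_set_scope.
Local Open Scope ring_scope.

(* Borel sigma-algebra of the usual topology. *)
HB.instance Definition _ (R : realType) (m n : nat) :=
  Measurable.copy 'M[R]_(m, n) (g_sigma_algebraType (@open 'M[R]_(m, n))).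

Section convex_analysis.
Variables (R : realType) (m : nat).
Local Notation V := 'rV[R]_m.
Implicit Types (nrm : V -> R) (f : V -> \bar R) (X : set V) (x y z : V).

Definition dot x y : R := \sum_(i < m) x ord0 i * y ord0 i.

Record is_norm nrm : Prop := IsNorm {
  is_norm_triangle : forall x y, nrm (x + y) <= nrm x + nrm y ;
  is_norm_scale : forall (a : R) x, nrm (a *: x) = `|a| * nrm x ;
  is_norm_eq0 : forall x, nrm x = 0 -> x = 0 }.

Definition dual_norm nrm z : \bar R :=
  ereal_sup [set (dot z x)%:E | x in [set x | nrm x <= 1]].

Definition proper_efun f : Prop := (exists x, f x < +oo)%E /\ (forall x, -oo < f x)%E.

(* The sum is taken in the dual scope %dE, where oo - oo = oo; together with
   0 * oo = 0 this is Jensen's inequality in the extended arithmetic of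
   minimisation. *)
Definition convex_efun f : Prop := forall x y (t : R), 0 <= t <= 1 ->
  (f (t *: x + (1 - t) *: y)%R <= (t%:E * f x + (1 - t)%R%:E * f y)%dE)%E.

Definition conjugate f z : \bar R :=
  ereal_sup [set ((dot z x)%:E - f x)%dE | x in [set: V]].

Definition support_function X z : \bar R :=
  ereal_sup [set (dot z x)%:E | x in X].

End convex_analysis.

Section empirical.
Variables (R : realType) (m N : nat) (xihat : 'I_N -> 'rV[R]_m).
Local Open Scope ereal_scope.

Definition empirical (A : set 'rV[R]_m) : \bar R :=
  (N%:R^-1)%:E * \sum_(i < N) \d_(xihat i) A.

Let empirical0 : empirical set0 = 0.
Proof. by rewrite /empirical big1 ?mule0// => i _; rewrite measure0. Qed.

Let empirical_ge0 A : 0 <= empirical A.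
Proof. by rewrite mule_ge0 ?lee_fin ?invr_ge0// sume_ge0. Qed.

Let empirical_sigma_additive : semi_sigma_additive empirical.
Proof.
move=> F mF tF mUF; rewrite /empirical.
have -> : (fun n => \sum_(0 <= k < n)
      (N%:R^-1 : R)%:E * \sum_(i < N) \d_(xihat i) (F k)) =
    (fun n => (N%:R^-1 : R)%:E *
      \sum_(i < N) \sum_(0 <= k < n) \d_(xihat i) (F k)).
  apply/funext => n; rewrite -ge0_sume_distrr; last first.
    by move=> k _; exact: sume_ge0.
  by rewrite exchange_big.
apply: cvgeZl => //; apply: cvg_nnesum.
  by move=> i _; apply: nearW => n; exact: sume_ge0.
by move=> i _; exact: measure_semi_sigma_additive.
Qed.

HB.instance Definition _ := isMeasure.Build _ _ _ empirical
  empirical0 empirical_ge0 empirical_sigma_additive.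

Lemma empirical_setT : (0 < N)%N -> empirical setT = 1.
Proof.
move=> N0; rewrite /empirical (eq_bigr (fun=> 1)); last first.
  by move=> i _; rewrite diracT.
rewrite sumEFin -EFinM big_const_ord iter_addr_0 mulVf//.
by rewrite pnatr_eq0 -lt0n.
Qed.

End empirical.

Section wasserstein.
Variables (R : realType) (m : nat).
Local Notation V := 'rV[R]_m.
Variables (nrm : V -> R) (Xi : set V).

(* %dE : the sum is +oo when the two parts are infinite of opposite signs. *)
Definition expect (Q : probability V R) (f : V -> \bar R) : \bar R :=
  ((\int[Q]_x maxe (f x) 0)%E + (\int[Q]_x mine (f x) 0)%E)%dE.

Definition distributions : set (probability V R) :=
  [set Q | Q Xi = 1%E /\ (\int[Q]_x (nrm x)%:E < +oo)%E].

Definition couplings (P Q : {measure set V -> \bar R}) : set (probability (V * V)%type R) :=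
  [set Pi | forall A, measurable A ->
     pushforward Pi fst A = P A /\ pushforward Pi snd A = Q A].

Definition wasserstein (P Q : {measure set V -> \bar R}) : \bar R :=
  ereal_inf [set \int[Pi]_(u in Xi `*` Xi) (nrm (u.1 - u.2)%R)%:E
            | Pi in couplings P Q]%E.

Definition wasserstein_ball (P : {measure set V -> \bar R}) (eps : R) :
    set (probability V R) :=
  [set Q | distributions Q /\ (wasserstein P Q <= eps%:E)%E].

End wasserstein.

Section convex_program.
Variables (R : realType) (m N K : nat).
Local Notation V := 'rV[R]_m.
Variables (nrm : V -> R) (Xi : set V) (xihat : 'I_N -> V).
Variables (ell : 'I_K -> V -> \bar R) (eps : R).

(* (lambda, s, z, nu) *)
Definition decision : lmodType R :=
  (R^o * ('I_N -> R^o) * ('I_N -> 'I_K -> V) * ('I_N -> 'I_K -> V))%type.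

Definition objective (d : decision) : R :=
  let: (lam, s, _, _) := d in lam * eps + N%:R^-1 * \sum_(i < N) s i.

Definition feasible : set decision :=
  [set d | let: (lam, s, z, nu) := d in
    (forall i k,
      (conjugate (fun x => - ell k x) (z i k - nu i k)%R
         + support_function Xi (nu i k) - (dot (z i k) (xihat i))%:E
       <= (s i)%:E)%dE) /\
    (forall i k, (dual_norm nrm (z i k) <= lam%:E)%E)].

Definition optimal_value : \bar R :=
  ereal_inf [set (objective d)%:E | d in feasible].

End convex_program.

(* Main.v *)
Require Import Defs.
From HB Require Import structures.
From mathcomp Require Import all_boot all_order all_algebra.
From mathcomp Require Import all_classical all_reals all_analysis measurable_realfun.
From mathcomp Require Import ring lra.

Import Order.TTheory GRing.Theory Num.Theory.
Import numFieldNormedType.Exports.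

Local Open Scope classical_set_scope.
Local Open Scope ring_scope.

Set Implicit Arguments.
Unset Strict Implicit.
Unset Printing Implicit Defensive.

(** Write [|.|] for the norm, [xh i] for the data points, [loss] for the maximum of
    the [ell k] and [cost i x] for [|x - xh i|]. The proof goes through the
    intermediate problem of minimising [l * eps + avg s] over [l >= 0] and [s]
    subject to the robust bound

      [loss x <= s i + l * cost i x] for all [i] and all [x] in [Xi].

    The expectation never exceeds the value of the robust bound
    ([expect_le_robust]): for a coupling of the empirical distribution with [Q],
    the loss at the end point is at most the value of the robust bound at the
    starting point plus [l] times the distance, and one integrates. Since the best
    such value is a Lipschitz function of the starting point, the coupling need not
    be disintegrated.

    Conversely, the robust bound can be met up to any [delta > 0] by testing very few
    distributions ([robust_bound]): a plan sends each data point to one point of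
    [Xi], and only mixtures of two plans are needed, because the trade-off between
    average cost and average loss lives in the plane. If some plan of finite loss
    costs less than [eps], a supergradient of the concave envelope of this trade-off
    is a multiplier [l]. If not, then [eps] is at most the average distance of
    the data points to the domain of the loss. A plan of cost [eps] can then only
    use nearest points of the domain, and compactness with upper semicontinuity
    shows that a large [l] does as well. This second case contains [eps = 0] and all
    the situations where the worst-case expectation is minus infinity.

    The robust bound at [(i, k)] says that [- ell k + l |. - xh i|] is at least
    [- s i] on [Xi], and a pair [(z, nu)] feasible for the program is a dual
    certificate of this fact, which splits it into affine bounds for [- ell k],
    for the indicator of [Xi] and for the norm ([dual_certificate]). Without a
    constraint qualification there need not be an exact certificate, but there is
    one after [l] and [s i] are increased by an arbitrary positive amount: the
    larger [l] makes the problem coercive, so that evaluating [- ell k] and the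
    indicator of [Xi] at different points can be penalised
    ([distance_penalty]), and the Hahn-Banach theorem applies twice. As the objective
    depends continuously on [l] and [s], the infima agree.

    Epigraphs are handled as relations between points and reals, so that
    extended-real arithmetic occurs only where they are formed ([convex_rel_epi])
    and where the program and the expectation are unfolded ([constraintP],
    [expectE]). *)

(** * The pairing and norms on row vectors *)

Section dot_product.
Context {R : realType} {m : nat}.
Local Notation V := 'rV[R]_m.
Implicit Types x y z : V.

Lemma dotC x y : dot x y = dot y x.
Proof. by apply: eq_bigr => i _; rewrite mulrC. Qed.

Lemma dotDl x y z : dot (x + y) z = dot x z + dot y z.
Proof. by rewrite -big_split; apply: eq_bigr => i _; rewrite mxE mulrDl. Qed.

Lemma dotZl (a : R) x y : dot (a *: x) y = a * dot x y.
Proof. by rewrite mulr_sumr; apply: eq_bigr => i _; rewrite mxE mulrA. Qed.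

Lemma dotNl x y : dot (- x) y = - dot x y.
Proof. by rewrite -scaleN1r dotZl mulN1r. Qed.

Lemma dotBl x y z : dot (x - y) z = dot x z - dot y z.
Proof. by rewrite dotDl dotNl. Qed.

Lemma dotDr x y z : dot x (y + z) = dot x y + dot x z.
Proof. by rewrite dotC dotDl !(dotC x). Qed.

Lemma dotZr (a : R) x y : dot x (a *: y) = a * dot x y.
Proof. by rewrite dotC dotZl (dotC x). Qed.

Lemma dotNr x y : dot x (- y) = - dot x y.
Proof. by rewrite dotC dotNl (dotC x). Qed.

Lemma dotBr x y z : dot x (y - z) = dot x y - dot x z.
Proof. by rewrite dotDr dotNr. Qed.

Lemma dot0l x : dot 0 x = 0.
Proof. by rewrite -(scale0r x) dotZl mul0r. Qed.

Lemma dot0r x : dot x 0 = 0.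
Proof. by rewrite dotC dot0l. Qed.

End dot_product.

Section norm.
Context {R : realType} {m : nat}.
Local Notation V := 'rV[R]_m.
Context (nrm : V -> R) (hnrm : is_norm nrm).
Implicit Types x y z : V.

Lemma nrmD x y : nrm (x + y) <= nrm x + nrm y.
Proof. exact: is_norm_triangle hnrm x y. Qed.

Lemma nrmZ a x : nrm (a *: x) = `|a| * nrm x.
Proof. exact: is_norm_scale hnrm a x. Qed.

Lemma nrm0 : nrm 0 = 0.
Proof. by rewrite -(scale0r (0 : V)) nrmZ normr0 mul0r. Qed.

Lemma nrmN x : nrm (- x) = nrm x.
Proof. by rewrite -scaleN1r nrmZ normrN1 mul1r. Qed.

Lemma nrmC x y : nrm (x - y) = nrm (y - x).
Proof. by rewrite -nrmN opprB. Qed.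

Lemma nrm_ge0 x : 0 <= nrm x.
Proof. have := nrmD x (- x); rewrite subrr nrm0 nrmN; lra. Qed.

Lemma nrm_gt0 x : x != 0 -> 0 < nrm x.
Proof.
move=> x0; rewrite lt_neqAle nrm_ge0 andbT eq_sym.
by apply: contra x0 => /eqP/(is_norm_eq0 hnrm) ->.
Qed.

Lemma nrm_dist x y z : nrm (x - z) <= nrm (x - y) + nrm (y - z).
Proof. by rewrite (le_trans _ (nrmD _ _))// subrKA. Qed.

Lemma nrmB_le x y : nrm x - nrm y <= nrm (x - y).
Proof. have := nrmD (x - y) y; rewrite subrK; lra. Qed.

Lemma nrm_sum (I : Type) (r : seq I) (P : pred I) (F : I -> V) :
  nrm (\sum_(i <- r | P i) F i) <= \sum_(i <- r | P i) nrm (F i).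
Proof.
elim/big_ind2 : _ => [|x a y b xa yb|//]; first by rewrite nrm0.
by rewrite (le_trans (nrmD _ _))// lerD.
Qed.

Lemma nrm_le_coord x :
  nrm x <= \sum_(i < m) `|x ord0 i| * nrm (delta_mx ord0 i).
Proof.
rewrite [in leLHS](row_sum_delta x) (le_trans (nrm_sum _ _ _))//.
by apply: ler_sum => i _; rewrite nrmZ.
Qed.

Lemma coord_le_mx_norm x i : `|x ord0 i| <= `|x|.
Proof.
rewrite [leRHS]/Num.norm/= mx_normrE.
by apply: (le_bigmax _ (fun ij => `|x ij.1 ij.2|) (ord0, i)).
Qed.

Lemma nrm_le_mx_norm : exists2 C : R, 0 < C & forall x, nrm x <= C * `|x|.
Proof.
pose C := \sum_(i < m) nrm (delta_mx ord0 i).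
have C0 : 0 <= C by apply: sumr_ge0 => i _; exact: nrm_ge0.
exists (C + 1) => [|x]; first lra.
rewrite (le_trans (nrm_le_coord x))//.
apply: (@le_trans _ _ (C * `|x|)); last by rewrite ler_wpM2r//; lra.
rewrite mulr_suml; apply: ler_sum => i _.
by rewrite mulrC ler_wpM2l ?nrm_ge0// coord_le_mx_norm.
Qed.

Lemma continuous_nrm : continuous nrm.
Proof.
have [C C0 hC] := nrm_le_mx_norm.
move=> x; apply/(@cvgrPdist_lt R R^o _ (nbhs x)) => e e0.
have Ce : 0 < e / C by rewrite divr_gt0.
near=> y.
have h : `|x - y| < e / C.
  by near: y; apply: (@cvgr_dist_lt R V _ (nbhs x) (nbhs_filter x) id) => //; exact: cvg_id.
have : C * `|x - y| < e by rewrite mulrC -ltr_pdivlMr.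
have := hC (x - y); have := nrmB_le x y; have := nrmB_le y x.
rewrite nrmC => *; rewrite ltr_norml; apply/andP; split; lra.
Unshelve. all: by end_near. Qed.

Lemma continuous_nrmB y : continuous (fun x => nrm (x - y)).
Proof.
move=> x; apply: (@continuous_comp _ _ _ (fun x => x - y) nrm).
  by apply: (@cvgB R V V (nbhs x)); [exact: cvg_id|exact: cvg_cst].
exact: continuous_nrm.
Qed.

(** The unit sphere of the maximum norm is compact, so the continuous function
    [nrm] is bounded away from zero on it. *)
Lemma mx_norm_le_nrm : exists2 c : R, 0 < c & forall x, c * `|x| <= nrm x.
Proof.
pose S := [set x : V | `|x| = 1].
have cS : compact S.
  apply: bounded_closed_compact.
    by exists 1; split => // M M1 x /= ->; exact: ltW.
  rewrite (_ : S = (fun x => `|x|) @^-1` [set 1])//.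
  apply: closed_comp => [x _|]; last exact: closed_eq.
  exact: norm_continuous.
have [S0|] := pselect (S !=set0); last first.
  move=> S0; exists 1 => // x; have [->|x0] := eqVneq x 0.
    by rewrite normr0 mulr0 nrm0.
  exfalso; apply: S0; exists (`|x|^-1 *: x).
  by rewrite /S/= normrZ normfV normr_id mulVf// normr_eq0.
have [|y Sy ymin] := @EVT_min_rV R m nrm S S0 cS.
  exact/continuous_subspaceT/continuous_nrm.
have y1 : `|y| = 1 by move: Sy; rewrite inE.
exists (nrm y).
  by rewrite nrm_gt0// -normr_eq0 y1 oner_eq0.
move=> x; have [->|x0] := eqVneq x 0; first by rewrite normr0 mulr0 nrm0.
have nx : 0 < `|x| by rewrite normr_gt0.
have := ymin (`|x|^-1 *: x); rewrite nrmZ normfV normr_id.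
rewrite mulrC ler_pdivlMr// => ->//.
by rewrite inE /S/= normrZ normfV normr_id mulVf// normr_eq0.
Qed.

Lemma compact_nrm_ball (A : set V) (y : V) (r : R) : closed A ->
  compact (A `&` [set x | nrm (x - y) <= r]).
Proof.
move=> cA; have [c c0 hc] := mx_norm_le_nrm.
apply: bounded_closed_compact.
  exists ((r + nrm y) / c); split=> [|M hM]; [exact: num_real|move=> x [_ /= xr]].
  rewrite (le_trans _ (ltW hM))// ler_pdivlMr// mulrC (le_trans (hc x))//.
  have := nrmB_le x y; lra.
apply: closedI => //.
rewrite (_ : mkset _ = (fun x => nrm (x - y)) @^-1` [set t | t <= r])//.
apply: closed_comp => [x _|]; last exact: closed_le.
exact: continuous_nrmB.
Qed.

Lemma nbhs_nrm_ball (x : V) (A : set V) : nbhs x A ->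
  exists2 r : R, 0 < r & forall y, nrm (y - x) <= r -> A y.
Proof.
have [c c0 hc] := mx_norm_le_nrm.
move=> /nbhs_normP[e /= e0 eA].
exists (c * (e / 2)) => [|y yx]; first by rewrite mulr_gt0// divr_gt0.
apply: eA => /=; rewrite -opprB normrN.
have : c * `|y - x| <= c * (e / 2) by exact: le_trans (hc _) yx.
by rewrite ler_pM2l//; lra.
Qed.

(** The radii given by openness at the points of [K] can be made uniform by the
    near-covering form of compactness. *)
Lemma compact_uniform_nbhs (K U : set V) : compact K -> open U -> K `<=` U ->
  exists2 r : R, 0 < r & forall x y, K y -> nrm (x - y) <= r -> U x.
Proof.
move=> cK oU KU.
have h : \forall r \near 0^'+, K `<=` [set y | forall x, nrm (x - y) <= r -> U x].
  move/compact_near_coveringP : cK => /(_ _ (0^'+ : set_system R)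
    (fun r y => forall x, nrm (x - y) <= r -> U x)); apply => y Ky.
  have [r r0 hr] := @nbhs_nrm_ball y U (open_nbhs_nbhs (conj oU (KU _ Ky))).
  have r20 : 0 < r / 2 by rewrite divr_gt0.
  exists ([set z | nrm (z - y) < r / 2], [set e | e < r / 2]) => /=.
    split; last exact: nbhs_right_lt.
    have := @continuous_nrmB y y; move=> /(_ [set t | t < r / 2]).
    apply; rewrite subrr nrm0; exact: lt_nbhsl.
  move=> [z e] /= [zy er] x xz; apply: hr.
  have := nrm_dist x z y; lra.
have h0 : \forall r \near 0^'+, (0 : R) < r by exact: nbhs_right_gt.
have [r [r0 hr]] := filter_ex (filterI h0 h).
by exists r => // x y /hr; exact.
Qed.

Lemma dual_normP (z : V) (l : R) : (dual_norm nrm z <= l%:E)%E <->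
  0 <= l /\ forall x, dot z x <= l * nrm x.
Proof.
split=> [h|[l0 h]]; last first.
  apply: ge_ereal_sup => _ [x /= x1 <-]; rewrite lee_fin.
  by rewrite (le_trans (h x))// ler_piMr.
have hx x : nrm x <= 1 -> dot z x <= l.
  move=> x1; rewrite -lee_fin; apply: le_trans h; apply: ereal_sup_ubound.
  by exists x.
split=> [|x]; first by rewrite -(dot0r z) hx// nrm0.
have [->|x0] := eqVneq x 0; first by rewrite dot0r nrm0 mulr0.
have nx := nrm_gt0 x0.
rewrite -ler_pdivrMr// mulrC -dotZr hx//.
by rewrite nrmZ ger0_norm ?invr_ge0 ?nrm_ge0// mulVf// gt_eqF.
Qed.

End norm.

(** * Hahn-Banach separation in coordinates *)

Section hahn_banach.
Context {R : realType}.

(** A relation [A x t], read as a (not necessarily closed or upward closed)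
    epigraph, so that suprema and infima of real functions are not needed. *)
Definition convex_rel (V : lmodType R) (A : V -> R -> Prop) :=
  forall x y t u (p : R), 0 <= p <= 1 -> A x t -> A y u ->
    A (p *: x + (1 - p) *: y) (p * t + (1 - p) * u).

(** By convexity, a segment of [A] joining the two sides of the subspace [W] meets
    [W] above [phi]; hence every slope in the direction [e] imposed from one side
    is at most every slope imposed from the other. *)
Lemma hahn_banach_step (V : lmodType R) (A : V -> R -> Prop) (W : set V)
    (phi : V -> R) (e : V) :
  convex_rel A -> (forall x, exists t, A x t) ->
  (forall a b x y, W x -> W y -> W (a *: x + b *: y)) ->
  (forall a b x y, phi (a *: x + b *: y) = a * phi x + b * phi y) ->
  W 0 -> (forall x t, W x -> A x t -> phi x <= t) ->
  exists c, forall x a t, W x -> A (x + a *: e) t -> phi x + a * c <= t.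
Proof.
move=> cA fA cW lphi W0 hA.
pose S := [set r | exists x s t, [/\ W x, 0 < s, A (x - s *: e) t &
  r = (phi x - t) / s]].
have key x s t y a u : W x -> 0 < s -> A (x - s *: e) t ->
    W y -> 0 < a -> A (y + a *: e) u -> (phi x - t) / s <= (u - phi y) / a.
  move=> Wx s0 At Wy a0 Au.
  have sa : 0 < a + s by rewrite addr_gt0.
  pose p := a / (a + s).
  have p1 : 1 - p = s / (a + s) by rewrite /p; field; rewrite gt_eqF.
  have p01 : 0 <= p <= 1.
    by rewrite /p divr_ge0 ?(ltW a0) ?(ltW sa)//= ler_pdivrMr// mul1r; lra.
  have := cA _ _ _ _ _ p01 At Au.
  have -> : p *: (x - s *: e) + (1 - p) *: (y + a *: e) = p *: x + (1 - p) *: y.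
    rewrite scalerBr scalerDr !scalerA.
    have -> : (1 - p) * a = p * s by rewrite p1 /p; ring.
    by rewrite addrACA addrC [- _ + _]addrC subrr add0r.
  move/(hA _ _ (cW _ _ _ _ Wx Wy)); rewrite lphi p1 /p => h.
  have {}h : (a * phi x + s * phi y) / (a + s) <= (a * t + s * u) / (a + s).
    move: h; congr (_ <= _); field; by rewrite gt_eqF.
  move: h; rewrite ler_pM2r ?invr_gt0// => h.
  by rewrite ler_pdivrMr// mulrAC ler_pdivlMr//; lra.
have [t0 At0] := fA (0 - 1 *: e); have [u0 Au0] := fA (0 + 1 *: e).
have S0 : S ((phi 0 - t0) / 1) by exists 0, 1, t0.
have hS : has_sup S.
  split; first by exists ((phi 0 - t0) / 1).
  exists ((u0 - phi 0) / 1) => _ [x [s [t [Wx s0 At ->]]]].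
  exact: key Wx s0 At W0 ltr01 Au0.
exists (sup S) => x a t Wx.
have [a0 At|a0 At|->] := ltgtP a 0.
- have a0' : 0 < - a by rewrite oppr_gt0.
  have : (phi x - t) / - a <= sup S.
    apply: ub_le_sup; first by case: hS.
    by exists x, (- a), t; rewrite scaleNr opprK.
  by rewrite ler_pdivrMr//; lra.
- have : sup S <= (t - phi x) / a.
    apply: ge_sup; first by exists ((phi 0 - t0) / 1).
    move=> _ [y [s [u [Wy s0 Au ->]]]].
    exact: key Wy s0 Au Wx a0 At.
  by rewrite ler_pdivlMr//; lra.
- by rewrite scale0r addr0 mul0r addr0; exact: hA.
Qed.

Context {m : nat}.
Local Notation V := 'rV[R]_m.

Lemma hahn_banach (A : V -> R -> Prop) :
  convex_rel A -> (forall x, exists t, A x t) -> (forall t, A 0 t -> 0 <= t) ->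
  exists w : V, forall x t, A x t -> dot w x <= t.
Proof.
move=> cA fA A0.
(* extend the functional one coordinate at a time *)
pose W k := [set x : V | forall i : 'I_m, (k <= i)%N -> x ord0 i = 0].
suff /(_ m (leqnn m))[w hw] : forall k, (k <= m)%N ->
    exists w : V, forall x t, W k x -> A x t -> dot w x <= t.
  by exists w => x t; apply: hw => i; rewrite leqNgt ltn_ord.
elim=> [_|k ih km].
  exists 0 => x t Wx; suff -> : x = 0 by rewrite dot0r; exact: A0.
  by apply/rowP => i; rewrite Wx// mxE.
have [w hw] := ih (ltnW km).
pose j := Ordinal km; pose e : V := delta_mx ord0 j.
have [||||c hc] := @hahn_banach_step V A (W k) (dot w) e cA fA.
- by move=> a b x y Wx Wy i ki; rewrite !mxE Wx// Wy// !mulr0 addr0.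
- by move=> a b x y; rewrite dotDr !dotZr.
- by move=> i _; rewrite mxE.
- exact: hw.
exists (w + (c - w ord0 j) *: e) => x t Wx At.
pose y := x - x ord0 j *: e.
have ey (a : R) (z : V) : dot (a *: e) z = a * z ord0 j.
  rewrite dotZl /dot (bigD1 j)//= big1 ?addr0 ?mxE ?eqxx ?mul1r// => i ij.
  by rewrite mxE eqxx (negbTE ij) mul0r.
have Wy : W k y.
  move=> i; rewrite leq_eqVlt => /predU1P[ki|ki].
    have -> : i = j by apply: val_inj.
    by rewrite /y !mxE !eqxx mulr1 subrr.
  have ij : (i == j) = false by rewrite -val_eqE/= gtn_eqF.
  by rewrite /y !mxE ij andbF mulr0 subr0 Wx.
have := hc y (x ord0 j) t Wy; rewrite /y subrK => /(_ At).
by rewrite dotBr dotDl ey (dotC w (_ *: e)) ey; lra.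
Qed.

(** Hahn-Banach applied to the inf-convolution [B] of [A] with [n |.|], which unlike
    [A] is finite everywhere; at [v] it is at most a constant plus [n |v|], which bounds
    the dual norm of the slope. *)
Lemma sandwich (nrm : V -> R) (hnrm : is_norm nrm) (A : V -> R -> Prop)
    (n tau : R) : 0 <= n -> convex_rel A -> (exists x t, A x t) ->
  (forall x t, A x t -> tau <= t + n * nrm x) ->
  exists w, (forall v, dot w v <= n * nrm v) /\
    (forall x t, A x t -> tau + dot w x <= t).
Proof.
move=> n0 cA [x0 [t0 At0]] hA.
pose B (v : V) (s : R) := exists x t, A x t /\ t + n * nrm (v - x) - tau <= s.
have [|||w hw] := @hahn_banach B.
- move=> v v' s s' p p01 [x [t [At hs]]] [x' [t' [At' hs']]].
  exists (p *: x + (1 - p) *: x'), (p * t + (1 - p) * t'); split; first exact: cA.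
  have -> : p *: v + (1 - p) *: v' - (p *: x + (1 - p) *: x') =
      p *: (v - x) + (1 - p) *: (v' - x').
    by rewrite !scalerBr opprD addrACA.
  have := nrmD hnrm (p *: (v - x)) ((1 - p) *: (v' - x')).
  have /andP[p0 p1] := p01.
  rewrite !(nrmZ hnrm) (ger0_norm p0) ger0_norm; last lra.
  move=> /(ler_wpM2l n0); rewrite mulrDr.
  have := ler_wpM2l p0 hs; have := @ler_wpM2l _ (1 - p) _ _ _ hs'.
  nra.
- move=> v; exists (t0 + n * nrm (v - x0) - tau), x0, t0; split => //.
- move=> s [x [t [At]]]; rewrite sub0r (nrmN hnrm); have := hA _ _ At; lra.
exists w; split=> [v|x t At]; last first.
  have : B x (t - tau).
    by exists x, t; split => //; rewrite subrr (nrm0 hnrm) mulr0 addr0.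
  by move/hw; lra.
have key s : 0 < s -> dot w v <= n * nrm v + (t0 - tau + n * nrm x0) / s.
  move=> s0; have : B (s *: v) (t0 + n * (s * nrm v + nrm x0) - tau).
    exists x0, t0; split => //; rewrite lerD2r lerD2l ler_wpM2l//.
    have := nrmD hnrm (s *: v) (- x0).
    by rewrite (nrmN hnrm) (nrmZ hnrm) (gtr0_norm s0).
  move/hw; rewrite dotZr mulrC -ler_pdivlMr// => /le_trans; apply.
  rewrite le_eqVlt; apply/orP; left; apply/eqP; field; exact: lt0r_neq0.
have q0 : 0 <= t0 - tau + n * nrm x0 by have := hA _ _ At0; lra.
apply/ler_addgt0Pr => r r0.
apply: (le_trans (key ((t0 - tau + n * nrm x0 + 1) / r) _)).
  by rewrite divr_gt0//; lra.
rewrite lerD2l invf_div mulrA ler_pdivrMr; last lra.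
rewrite mulrC ler_wpM2l//; lra.
Qed.

End hahn_banach.

(** * Convex lower semicontinuous functions *)

Section convex_functions.
Context {R : realType} {m : nat}.
Local Notation V := 'rV[R]_m.
Context (nrm : V -> R) (hnrm : is_norm nrm).

Definition epi (f : V -> \bar R) (x : V) (t : R) := (f x <= t%:E)%E.

Lemma proper_epi (f : V -> \bar R) : proper_efun f -> exists x t, f x = t%:E.
Proof.
move=> [[x fx] /(_ x)]; move: fx.
by case E : (f x) => [t| |]// _ _; exists x, t.
Qed.

Lemma convex_rel_epi (f : V -> \bar R) :
  proper_efun f -> convex_efun f -> convex_rel (epi f).
Proof.
move=> [_ f_ninfty] cf x y t u p p01 /= fxt fyu.
apply: (le_trans (cf x y p p01)); move: fxt fyu; rewrite /epi.
have := f_ninfty x; have := f_ninfty y; have /andP[p0 p1] := p01.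
case: (f x) => [a| |]//; case: (f y) => [b| |]// _ _; rewrite !lee_fin => at' bu.
by rewrite lerD// ler_wpM2l// subr_ge0.
Qed.

Lemma open_lsc_gt (f : V -> \bar R) (g : V -> R) :
  lower_semicontinuous f -> continuous g -> open [set x | ((g x)%:E < f x)%E].
Proof.
move=> /lower_semicontinuousP lf cg; rewrite openE => x /= gf.
have [a ga af] : exists2 a, g x < a & (a%:E < f x)%E.
  move: gf; case: (f x) => [r| |]//; last by exists (g x + 1); rewrite ?ltry//; lra.
  by rewrite lte_fin => gr; exists ((g x + r) / 2); rewrite ?lte_fin; lra.
have fa : nbhs x [set y | (a%:E < f y)%E] by apply: open_nbhs_nbhs; split => //; exact: lf.
have gxa : nbhs x [set y | g y < a] by apply: (cg x [set t | t < a]); exact: lt_nbhsl.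
apply: filterS2 fa gxa => y /= fy gy.
by apply: lt_trans fy; rewrite lte_fin.
Qed.

(** Near a point of its domain a lower semicontinuous function is bounded below;
    convexity transports this bound to the whole space as a cone. *)
Lemma cone_minorant (f : V -> \bar R) (y : V) :
  proper_efun f -> convex_efun f -> lower_semicontinuous f ->
  exists a L : R, 0 <= L /\ forall x t, epi f x t -> a - L * nrm (x - y) <= t.
Proof.
move=> pf cf lf; have cA := convex_rel_epi pf cf.
have [x0 [t0 fx0]] := proper_epi pf.
have oU := @open_lsc_gt f (fun=> t0 - 1) lf (@cst_continuous _ _ _).
have [|r r0 hr] := @nbhs_nrm_ball _ _ _ hnrm x0 _ (open_nbhs_nbhs (conj oU _)).
  by rewrite /= fx0 lte_fin; lra.
exists (t0 - 1 - r^-1 * nrm (y - x0)), r^-1; split=> [|x t fxt].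
  by rewrite invr_ge0 ltW.
have ir : 0 <= r^-1 by rewrite invr_ge0 ltW.
suff : t0 - 1 - r^-1 * nrm (x - x0) <= t.
  by have := ler_wpM2l ir (nrm_dist hnrm x y x0); lra.
have d0 := nrm_ge0 hnrm (x - x0).
have [xr|xr] := leP (nrm (x - x0)) r.
  have /= := lt_le_trans (hr _ xr) fxt; rewrite lte_fin.
  by have := mulr_ge0 ir d0; lra.
set d := nrm (x - x0) in d0 xr *.
have dp : 0 < d by exact: lt_trans xr.
pose p := r / d.
have p01 : 0 <= p <= 1.
  by rewrite /p divr_ge0 ?(ltW r0) ?(ltW dp)//= ler_pdivrMr// mul1r ltW.
have := cA _ _ _ _ p p01 fxt (_ : epi f x0 t0); rewrite /epi fx0 lexx => /(_ isT).
move=> /(lt_le_trans (hr _ _))/=; rewrite lte_fin.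
have -> : p *: x + (1 - p) *: x0 - x0 = p *: (x - x0).
  by rewrite scalerBl scale1r scalerBr addrA addrAC addrK.
have /andP[p0 _] := p01.
rewrite (nrmZ hnrm) ger0_norm// -/d /p divfK ?gt_eqF// => /(_ (lexx _)) h.
have : - 1 < r / d * (t - t0) by lra.
rewrite mulrAC ltr_pdivlMr// => {}h.
have : r^-1 * (- 1 * d) < r^-1 * (r * (t - t0)) by rewrite ltr_pM2l ?invr_gt0.
by rewrite mulKf ?gt_eqF//; lra.
Qed.

(** On [Xi] the function [f + l' |. - xh|] exceeds [tau] and is coercive, so by
    lower semicontinuity and compactness it still exceeds [tau] on a uniform
    neighbourhood of the bounded part of [Xi]; contracting towards a point [y0]
    of the domain extends this to the neighbourhood of all of [Xi], and then, at
    the price of a multiple of the distance to [Xi], to the whole space.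
    Without the increase from [l] to [l'] the conclusion may fail. *)
Lemma distance_penalty (f : V -> \bar R) (Xi : set V) (xh y0 : V)
    (t0 s l l' tau : R) :
  proper_efun f -> convex_efun f -> lower_semicontinuous f ->
  closed Xi -> (forall x y p, 0 <= p <= 1 -> Xi x -> Xi y ->
    Xi (p *: x + (1 - p) *: y)) ->
  Xi y0 -> epi f y0 t0 -> 0 <= l -> l < l' -> tau < - s ->
  (forall y t, Xi y -> epi f y t -> - s <= t + l * nrm (y - xh)) ->
  exists2 n : R, 0 <= n & forall x y t, Xi y -> epi f x t ->
    tau <= t + l' * nrm (y - xh) + n * nrm (x - y).
Proof.
move=> pf cf lf cXi cvXi Xy0 fy0 l0 ll' taus hXi.
have cA := convex_rel_epi pf cf.
have l'0 : 0 < l' by exact: le_lt_trans ll'.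
pose h0 := t0 + l' * nrm (y0 - xh).
have h0s : - s <= h0.
  have := hXi _ _ Xy0 fy0; rewrite /h0.
  by have := ler_wpM2r (nrm_ge0 hnrm (y0 - xh)) (ltW ll'); lra.
(* on Xi, the excess (l' - l) |. - xh| lifts the value above h0 at distance r *)
pose r := nrm (y0 - xh) + (h0 + s + 1) / (l' - l).
have r0 : 0 < r.
  by rewrite ltr_wpDl ?(nrm_ge0 hnrm)// divr_gt0//; lra.
pose U c := [set x | ((c - l' * nrm (x - xh))%:E < f x)%E].
have oU c : open (U c).
  apply: (@open_lsc_gt f (fun x => c - l' * nrm (x - xh))) => // x.
  apply: (@cvgB R R^o V (nbhs x)); first exact: cvg_cst.
  by apply: (@cvgM R V (nbhs x)); [exact: cvg_cst|exact: continuous_nrmB].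
have epiU c x t : U c x -> epi f x t -> c < t + l' * nrm (x - xh).
  by move=> Ux /(lt_le_trans Ux); rewrite lte_fin; lra.
have UXi c x : Xi x -> c < - s + (l' - l) * nrm (x - xh) -> U c x.
  move=> Xx hc; rewrite /U/=; have := hXi x; rewrite /epi.
  case: (f x) (pf.2 x) => [t| |]//.
  - by move=> _ /(_ t Xx (lexx _)); rewrite lte_fin; lra.
  - by move=> _ _; rewrite ltry.
pose ball_r := [set x | nrm (x - y0) <= r].
pose sphere := (Xi `&` ball_r) `&` [set x | r <= nrm (x - y0)].
have cK : compact (Xi `&` ball_r) by exact: (compact_nrm_ball hnrm).
have csphere : compact sphere.
  have cl : closed [set x | r <= nrm (x - y0)].
    rewrite (_ : mkset _ = (fun x => nrm (x - y0)) @^-1` [set t | r <= t])//.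
    apply: closed_comp => [x _|]; last exact: closed_ge.
    exact: continuous_nrmB.
  rewrite /sphere -setIA (setIC ball_r) setIA.
  by apply: (compact_nrm_ball hnrm); exact: closedI.
have [|r1 r10 hr1] := compact_uniform_nbhs hnrm cK (oU tau).
  move=> y [Xy _]; apply: UXi => //.
  have := nrm_ge0 hnrm (y - xh) => ?; have : 0 <= (l' - l) * nrm (y - xh).
    by rewrite mulr_ge0//; lra.
  lra.
have [|r2 r20 hr2] := compact_uniform_nbhs hnrm csphere (oU h0).
  move=> y [[Xy _] /= ry]; apply: UXi => //.
  have : (h0 + s + 1) / (l' - l) <= nrm (y - xh).
    by have := nrm_dist hnrm y xh y0; rewrite (nrmC hnrm xh); rewrite /r in ry; lra.
  by rewrite ler_pdivrMr; lra.
have contr p x y : p *: x + (1 - p) *: y0 - (p *: y + (1 - p) *: y0) = p *: (x - y).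
  by rewrite opprD addrACA subrr addr0 scalerBr.
have contr0 p x : p *: x + (1 - p) *: y0 - y0 = p *: (x - y0).
  rewrite -(contr p x y0) -scalerDl addrCA subrr addr0 scale1r //.
have cvh p x : 0 <= p <= 1 -> nrm (p *: x + (1 - p) *: y0 - xh) <=
    p * nrm (x - xh) + (1 - p) * nrm (y0 - xh).
  move=> /andP[p0 p1].
  have -> : p *: x + (1 - p) *: y0 - xh = p *: (x - xh) + (1 - p) *: (y0 - xh).
    by rewrite !scalerBr addrACA -opprD -scalerDl addrCA subrr addr0 scale1r.
  apply: (le_trans (nrmD hnrm _ _)); rewrite !(nrmZ hnrm).
  by rewrite ger0_norm// ger0_norm// subr_ge0.
pose d := Num.min r1 r2.
have d0 : 0 < d by rewrite lt_min r10 r20.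
(* beyond the sphere, contract to it: there the value exceeds h0, the value at
   y0, so by convexity it exceeds h0 at the original point too *)
have near_Xi x y t : Xi y -> nrm (x - y) <= d -> epi f x t ->
    tau <= t + l' * nrm (x - xh).
  move=> Xy; rewrite le_min => /andP[xy1 xy2] fxt.
  have [yr|yr] := leP (nrm (y - y0)) r.
    by apply: ltW; apply: epiU fxt; apply: (hr1 _ y).
  pose p := r / nrm (y - y0).
  have ny0 : 0 < nrm (y - y0) by exact: lt_trans yr.
  have p01 : 0 <= p <= 1.
    by rewrite /p divr_ge0 ?(ltW r0) ?(ltW ny0)//= ler_pdivrMr// mul1r ltW.
  have /andP[p0 p1] := p01.
  have pp : 0 < p by rewrite divr_gt0.
  have : U h0 (p *: x + (1 - p) *: y0).
    apply: (hr2 _ (p *: y + (1 - p) *: y0)).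
      have nr : nrm (p *: y + (1 - p) *: y0 - y0) = r.
        by rewrite contr0 (nrmZ hnrm) ger0_norm// /p divfK// gt_eqF.
      by split; [split; [exact: cvXi|rewrite /ball_r/= nr]|rewrite /= nr].
    rewrite contr (nrmZ hnrm) ger0_norm//; apply: le_trans xy2.
    by rewrite ler_piMl// (nrm_ge0 hnrm).
  move=> /epiU/(_ (cA _ _ _ _ p p01 fxt fy0)) hU.
  have : p * h0 < p * (t + l' * nrm (x - xh)).
    have := ler_wpM2l (ltW l'0) (cvh p x p01); rewrite /h0 in hU *; lra.
  by rewrite ltr_pM2l//; lra.
(* n is the slope of the segment from h0 at y0 down to tau at distance d *)
pose n := (h0 - tau) / d.
have n0 : 0 <= n by rewrite divr_ge0// ?(ltW d0)//; lra.
have pen x y t : Xi y -> epi f x t ->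
    tau <= t + l' * nrm (x - xh) + n * nrm (x - y).
  move=> Xy fxt; have nxy := nrm_ge0 hnrm (x - y).
  have [xyd|xyd] := leP (nrm (x - y)) d.
    by have := near_Xi _ _ _ Xy xyd fxt; have := mulr_ge0 n0 nxy; lra.
  have nxy0 : 0 < nrm (x - y) by exact: lt_trans xyd.
  pose p := d / nrm (x - y).
  have p01 : 0 <= p <= 1.
    by rewrite /p divr_ge0 ?(ltW d0) ?(ltW nxy0)//= ler_pdivrMr// mul1r ltW.
  have /andP[p0 p1] := p01.
  have := near_Xi (p *: x + (1 - p) *: y0) (p *: y + (1 - p) *: y0) _
    (cvXi _ _ _ p01 Xy Xy0) _ (cA _ _ _ _ p p01 fxt fy0).
  rewrite contr (nrmZ hnrm) ger0_norm// {1}/p divfK ?gt_eqF// => /(_ (lexx _)) hh.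
  have : p * (h0 - (t + l' * nrm (x - xh))) <= h0 - tau.
    have := ler_wpM2l (ltW l'0) (cvh p x p01); rewrite /h0 in hh *; lra.
  rewrite /p mulrAC ler_pdivrMr// => h1.
  have : h0 - (t + l' * nrm (x - xh)) <= n * nrm (x - y).
    by rewrite /n mulrAC ler_pdivlMr// mulrC.
  lra.
exists (n + l') => [|x y t Xy fxt]; first lra.
have := pen x y t Xy fxt.
by have := ler_wpM2l (ltW l'0) (nrm_dist hnrm x y xh); lra.
Qed.

End convex_functions.

(** * Growth bounds and dual certificates *)

Section growth_certificate.
Context {R : realType} {m : nat}.
Local Notation V := 'rV[R]_m.
Context (nrm : V -> R) (hnrm : is_norm nrm).

(** Away from [xh] the bound comes from the conical minorant of [f]; near the
    ball of radius [d], compactness keeps the sublevel set of level [- r] of [f]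
    at a positive distance from the ball. *)
Lemma growth_outside_ball (f : V -> \bar R) (Xi : set V) (xh : V) (d r : R) :
  proper_efun f -> convex_efun f -> lower_semicontinuous f -> closed Xi ->
  (forall x t, Xi x -> epi f x t -> d <= nrm (x - xh)) ->
  (forall x t, Xi x -> nrm (x - xh) <= d -> epi f x t -> - r < t) ->
  exists2 l0 : R, 0 <= l0 & forall l, l0 <= l -> forall x t, Xi x -> epi f x t ->
    - t <= r + l * (nrm (x - xh) - d).
Proof.
move=> pf cf lf cXi hd hr.
have [a [L [L0 hL]]] := cone_minorant hnrm xh pf cf lf.
have [mu mu0 hmu] : exists2 mu, 0 < mu &
    forall x, Xi x -> epi f x (- r) -> mu <= nrm (x - xh) - d.
  pose B := (Xi `&` [set x | (f x <= (- r)%:E)%E]) `&` [set x | nrm (x - xh) <= d + 1].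
  have cB : compact B.
    apply: (compact_nrm_ball hnrm); apply: closedI => //.
    rewrite (_ : mkset _ = ~` [set x | ((- r)%:E < f x)%E]).
      by apply: open_closedC; exact: (@open_lsc_gt _ _ f (fun=> - r) lf (@cst_continuous _ _ _)).
    by apply/seteqP; split => x /=; rewrite leNgt => /negP.
  have [B0|B0] := pselect (B !=set0); last first.
    exists 1 => // x Xx fx; rewrite leNgt; apply/negP => xd.
    by apply: B0; exists x; split; [split|rewrite /=; lra].
  have [|y By ymin] := @EVT_min_rV R m (fun x => nrm (x - xh)) B B0 cB.
    exact/continuous_subspaceT/continuous_nrmB.
  have [[Xy fy] yd] : B y by rewrite inE in By.
  have dy : d < nrm (y - xh).
    by rewrite ltNge; apply/negP => yd'; have := hr _ _ Xy yd' fy; rewrite ltxx.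
  exists (Num.min 1 (nrm (y - xh) - d)) => [|x Xx fx].
    by rewrite lt_min ltr01; lra.
  rewrite ge_min; have [xd|xd] := leP (nrm (x - xh)) (d + 1); last first.
    by apply/orP; left; lra.
  apply/orP; right; rewrite lerD2r; apply: ymin.
  by rewrite inE; split.
pose l0 := L + `|L * d - a - r| / mu.
have q0 : 0 <= `|L * d - a - r| / mu by rewrite divr_ge0// ltW.
exists l0 => [|l ll x t Xx fxt]; first by rewrite addr_ge0.
have xd := hd _ _ Xx fxt.
have l_ge0 : 0 <= l by rewrite (le_trans _ ll)// addr_ge0.
have e0 : 0 <= nrm (x - xh) - d by rewrite subr_ge0.
have [rt|rt] := ltP (- r) t; first by have := mulr_ge0 l_ge0 e0; lra.
have xmu : mu <= nrm (x - xh) - d.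
  by apply: hmu => //; apply: (le_trans fxt); rewrite lee_fin.
have h1 := hL _ _ fxt.
have h2 := ler_wpM2r e0 ll.
have h3 := ler_wpM2l q0 xmu.
have h4 := ler_norm (L * d - a - r).
by rewrite divfK ?gt_eqF// in h3; rewrite /l0 in h2; lra.
Qed.

(** Once [distance_penalty] allows [f] and the indicator of [Xi] to be evaluated at
    different points [x] and [y], the sandwich theorem separates them by a slope
    [w] acting on [x - y]; a second application, along [y - xh], separates the
    result from the norm by a slope [z], and [nu = z - w]. The increase [d] of [l]
    serves the penalisation. *)
Lemma dual_certificate (f : V -> \bar R) (Xi : set V) (xh : V) (s l d : R) :
  proper_efun f -> convex_efun f -> lower_semicontinuous f ->
  closed Xi -> (forall x y p, 0 <= p <= 1 -> Xi x -> Xi y ->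
    Xi (p *: x + (1 - p) *: y)) ->
  (exists x t, Xi x /\ epi f x t) -> 0 <= l -> 0 < d ->
  (forall y t, Xi y -> epi f y t -> - t <= s + l * nrm (y - xh)) ->
  exists z nu, (forall v, dot z v <= (l + d) * nrm v) /\
    forall x t y, epi f x t -> Xi y ->
      dot (z - nu) x - t + dot nu y - dot z xh <= s + d.
Proof.
move=> pf cf lf cXi cvXi [y0 [t0 [Xy0 fy0]]] l0 d0 hXi.
have cA := convex_rel_epi pf cf.
have [|||n n0 hn] := @distance_penalty _ _ _ hnrm f Xi xh y0 t0 s l (l + d)
  (- s - d) pf cf lf cXi cvXi Xy0 fy0 l0.
- lra.
- lra.
- by move=> y t Xy /(hXi _ _ Xy); lra.
have nrm_cvx p x y : 0 <= p <= 1 ->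
    nrm (p *: x + (1 - p) *: y - xh) <= p * nrm (x - xh) + (1 - p) * nrm (y - xh).
  move=> /andP[p0 p1].
  have -> : p *: x + (1 - p) *: y - xh = p *: (x - xh) + (1 - p) *: (y - xh).
    by rewrite !scalerBr addrACA -opprD -scalerDl addrCA subrr addr0 scale1r.
  apply: (le_trans (nrmD hnrm _ _)); rewrite !(nrmZ hnrm).
  by rewrite ger0_norm// ger0_norm// subr_ge0.
have comb p (x y x' y' : V) : p *: (x - y) + (1 - p) *: (x' - y') =
    p *: x + (1 - p) *: x' - (p *: y + (1 - p) *: y').
  by rewrite !scalerBr addrACA -opprD.
have ld0 : 0 <= l + d by lra.
pose A1 (v : V) (r : R) := exists x t y, [/\ epi f x t, Xi y, v = x - y &
  t + (l + d) * nrm (y - xh) <= r].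
have [|||w [_ hw]] := @sandwich _ _ _ hnrm A1 n (- s - d) n0.
- move=> v v' r r' p p01 [x [t [y [fxt Xy -> hr]]]] [x' [t' [y' [fxt' Xy' -> hr']]]].
  exists (p *: x + (1 - p) *: x'), (p * t + (1 - p) * t'), (p *: y + (1 - p) *: y').
  split; [exact: cA|exact: cvXi|exact: comb|].
  have /andP[p0 p1] := p01; have p1' : 0 <= 1 - p by rewrite subr_ge0.
  have := ler_wpM2l ld0 (nrm_cvx p y y' p01).
  by have := ler_wpM2l p0 hr; have := ler_wpM2l p1' hr'; lra.
- exists (y0 - y0), (t0 + (l + d) * nrm (y0 - xh)).
  by exists y0, t0, y0; split.
- move=> v r [x [t [y [fxt Xy -> hr]]]].
  by have := hn _ _ _ Xy fxt; lra.
pose A2 (v : V) (r : R) := exists x t y, [/\ epi f x t, Xi y, v = y - xh &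
  t - dot w (x - y) <= r].
have [|||z [zl hz]] := @sandwich _ _ _ hnrm A2 (l + d) (- s - d) ld0.
- move=> v v' r r' p p01 [x [t [y [fxt Xy -> hr]]]] [x' [t' [y' [fxt' Xy' -> hr']]]].
  exists (p *: x + (1 - p) *: x'), (p * t + (1 - p) * t'), (p *: y + (1 - p) *: y').
  split; [exact: cA|exact: cvXi| |].
    by rewrite comb -[in X in _ - X = _]scalerDl addrCA subrr addr0 scale1r.
  have /andP[p0 p1] := p01; have p1' : 0 <= 1 - p by rewrite subr_ge0.
  rewrite -comb dotDr !dotZr.
  by have := ler_wpM2l p0 hr; have := ler_wpM2l p1' hr'; lra.
- by exists (y0 - xh), (t0 - dot w (y0 - y0)), y0, t0, y0; split.
- move=> v r [x [t [y [fxt Xy -> hr]]]].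
  suff : A1 (x - y) (t + (l + d) * nrm (y - xh)) by move/hw; lra.
  by exists x, t, y; split.
exists z, (z - w); split => // x t y fxt Xy.
have : A2 (y - xh) (t - dot w (x - y)) by exists x, t, y; split.
by move/hz; rewrite subKr !dotBr dotBl; lra.
Qed.

End growth_certificate.

(** * Lagrange duality for transport plans *)

Section average.
Context {R : realType} {N : nat}.
Implicit Types F G : 'I_N -> R.

Definition avg F : R := N%:R^-1 * \sum_(i < N) F i.

Lemma avgD F G : avg (fun i => F i + G i) = avg F + avg G.
Proof. by rewrite /avg big_split/= mulrDr. Qed.

Lemma avgZ a F : avg (fun i => a * F i) = a * avg F.
Proof. by rewrite /avg -mulr_sumr mulrCA. Qed.

Lemma avgB F G : avg (fun i => F i - G i) = avg F - avg G.
Proof. by rewrite /avg sumrB mulrBr. Qed.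

Lemma avg_cst (hN : (0 < N)%N) a : avg (fun=> a) = a.
Proof.
by rewrite /avg sumr_const card_ord -[a *+ N]mulr_natl mulKf// pnatr_eq0 -lt0n.
Qed.

Lemma ler_avg F G : (forall i, F i <= G i) -> avg F <= avg G.
Proof. by move=> FG; rewrite ler_wpM2l ?invr_ge0// ler_sum. Qed.

End average.

Section plan_duality.
Context {R : realType}.

(** One-dimensional Lagrange duality at an interior point of the domain: [l] is a
    supergradient at [eps] of the concave envelope of the pairs (cost, value), of
    which only two-point mixtures matter. *)
Lemma multiplier_of_mixtures (P : R -> R -> Prop) (eps b c0 r0 : R) :
  (forall c r c' r' p, P c r -> P c' r' -> 0 <= p <= 1 ->
    p * c + (1 - p) * c' <= eps -> p * r + (1 - p) * r' <= b) ->
  P c0 r0 -> c0 < eps ->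
  exists2 l : R, 0 <= l & forall c r, P c r -> r - l * (c - eps) <= b.
Proof.
move=> hP P0 c0e.
have hle c r : P c r -> c <= eps -> r <= b.
  move=> Pc ce; have := hP _ _ _ _ 1 Pc Pc; rewrite subrr !mul0r !addr0 !mul1r.
  by apply => //; rewrite ler01 lexx.
have key c r c' r' : P c r -> eps < c -> P c' r' -> c' < eps ->
    (r - b) / (c - eps) <= (b - r') / (eps - c').
  move=> Pc ec Pc' c'e; pose p := (eps - c') / (c - c').
  have cc' : 0 < c - c' by lra.
  have p01 : 0 <= p <= 1.
    by rewrite divr_ge0 ?(ltW cc')//= ?ler_pdivrMr//; lra.
  have p1 : 1 - p = (c - eps) / (c - c') by rewrite /p; field; rewrite gt_eqF.
  have := hP _ _ _ _ p Pc Pc' p01; rewrite p1 /p.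
  have -> : (eps - c') / (c - c') * c + (c - eps) / (c - c') * c' = eps.
    by field; rewrite gt_eqF.
  move=> /(_ (lexx _)) h.
  have {}h : ((eps - c') * r + (c - eps) * r') / (c - c') <= b.
    by move: h; congr (_ <= _); field; rewrite gt_eqF.
  move: h; rewrite ler_pdivrMr// => h.
  rewrite ler_pdivrMr ?subr_gt0// mulrAC ler_pdivlMr ?subr_gt0//; lra.
pose S := [set l | l = 0 \/ exists c r, [/\ P c r, eps < c & l = (r - b) / (c - eps)]].
have Sub c r : P c r -> c < eps -> ubound S ((b - r) / (eps - c)).
  move=> Pc ce _ [->|[c' [r' [Pc' ec' ->]]]]; last exact: key.
  by rewrite divr_ge0 ?subr_ge0 ?(ltW ce)//; apply: hle Pc _; exact: ltW.
have S0 : S 0 by left.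
have hS : has_ubound S by exists ((b - r0) / (eps - c0)); exact: Sub.
exists (sup S) => [|c r Pc]; first exact: ub_le_sup.
have [ce|ec|ce] := ltgtP c eps.
- have : sup S <= (b - r) / (eps - c) by apply: ge_sup; [exists 0|exact: Sub].
  by rewrite ler_pdivlMr ?subr_gt0//; lra.
- have : (r - b) / (c - eps) <= sup S.
    by apply: ub_le_sup => //; right; exists c, r.
  by rewrite ler_pdivrMr ?subr_gt0//; lra.
- by rewrite ce subrr mulr0 subr0; apply: hle Pc _; rewrite ce.
Qed.

Context {T : Type} {N : nat} (hN : (0 < N)%N).
Variables (D : set T) (g : T -> R) (c : 'I_N -> T -> R) (eps b : R).

Definition two_plan_bound := forall (x y : 'I_N -> T) p,
  (forall i, D (x i)) -> (forall i, D (y i)) -> 0 <= p <= 1 ->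
  p * avg (fun i => c i (x i)) + (1 - p) * avg (fun i => c i (y i)) <= eps ->
  p * avg (fun i => g (x i)) + (1 - p) * avg (fun i => g (y i)) <= b.

(** A plan chooses a destination for every data point independently, so the
    supremum over plans of the averaged Lagrangian is the average of the
    suprema, which are the [s i]. *)
Lemma plan_multiplier (x0 : 'I_N -> T) :
  two_plan_bound -> (forall i, D (x0 i)) -> avg (fun i => c i (x0 i)) < eps ->
  exists l s, [/\ 0 <= l, forall i x, D x -> g x <= s i + l * c i x &
    l * eps + avg s <= b].
Proof.
move=> H Dx0 cx0.
pose P u r := exists x : 'I_N -> T, [/\ forall i, D (x i),
  u = avg (fun i => c i (x i)) & r = avg (fun i => g (x i))].
have [||l l0 hl] := @multiplier_of_mixtures P eps b (avg (fun i => c i (x0 i)))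
    (avg (fun i => g (x0 i))) _ _ cx0.
- by move=> _ _ _ _ p [x [Dx -> ->]] [y [Dy -> ->]]; exact: H.
- by exists x0.
pose v i x := g x - l * c i x.
have hv x : (forall i, D (x i)) -> avg (fun i => v i (x i)) <= b - l * eps.
  move=> Dx; have := hl (avg (fun i => c i (x i))) (avg (fun i => g (x i))).
  rewrite /v avgB avgZ => /(_ (ex_intro _ x (And3 Dx erefl erefl))); lra.
pose S i := [set v i x | x in D].
have SS i : has_sup (S i).
  split; first by exists (v i (x0 i)), (x0 i).
  exists (N%:R * (b - l * eps) - \sum_(j < N | j != i) v j (x0 j)) => _ [x Dx <-].
  have := hv (fun j => if j == i then x else x0 j) => h.
  have {}h : avg (fun j => v j (if j == i then x else x0 j)) <= b - l * eps.
    by apply: h => j; case: ifP.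
  move: h; rewrite /avg mulrC ler_pdivrMr ?ltr0n// (bigD1 i)//= eqxx.
  rewrite (eq_bigr (fun j => v j (x0 j))) => [|j /negbTE ->//].
  by rewrite mulrC; lra.
exists l, (fun i => sup (S i)); split => // [i x Dx|].
  have : v i x <= sup (S i) by apply: sup_upper_bound => //; exists x.
  by rewrite /v; lra.
suff : avg (fun i => sup (S i)) <= b - l * eps by lra.
apply/ler_addgt0Pr => e e0.
have /choice[x hx] : forall i, exists x, D x /\ sup (S i) - e < v i x.
  by move=> i; have [_ [x Dx <-] h] := sup_adherent e0 (SS i); exists x.
have := hv x (fun i => (hx i).1).
have : avg (fun i => sup (S i) - e) <= avg (fun i => v i (x i)).
  by apply: ler_avg => i; exact/ltW/(hx i).2.
by rewrite avgB avg_cst//; lra.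
Qed.

End plan_duality.

Section robust_bound.
Context {R : realType} {m N K : nat} (hN : (0 < N)%N).
Local Notation V := 'rV[R]_m.
Context (nrm : V -> R) (hnrm : is_norm nrm) (Xi : set V) (xh : 'I_N -> V).
Context (ell : 'I_K -> V -> \bar R).
Hypothesis cXi : closed Xi.
Hypothesis pf : forall k, proper_efun (fun x => - ell k x)%E.
Hypothesis cf : forall k, convex_efun (fun x => - ell k x)%E.
Hypothesis lf : forall k, lower_semicontinuous (fun x => - ell k x)%E.

Definition loss (x : V) : \bar R := (\big[maxe/-oo]_(k < K) ell k x)%E.

Lemma ell_lty k x : (ell k x < +oo)%E.
Proof. by have [_ /(_ x)] := pf k; case: (ell k x) => // r _; exact: ltry. Qed.

Lemma le_loss k x : (ell k x <= loss x)%E.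
Proof. exact: (le_bigmax _ (fun k => ell k x)). Qed.

Lemma loss_lty x : (loss x < +oo)%E.
Proof. by apply/bigmax_ltP; split => [|k _]; [by []|exact: ell_lty]. Qed.

Lemma epiE k x t : epi (fun x => - ell k x)%E x t <-> ((- t)%:E <= ell k x)%E.
Proof. by rewrite /epi leeNl EFinN. Qed.

Definition loss_dom := [set x | Xi x /\ loss x <> -oo%E].

Lemma loss_domE x : loss_dom x -> loss x = (fine (loss x))%:E.
Proof.
move=> [_ /eqP xN]; rewrite fineK// fin_numE xN/=.
by rewrite lt_eqF// loss_lty.
Qed.

Lemma epi_loss k x t : Xi x -> epi (fun x => - ell k x)%E x t ->
  loss_dom x /\ - t <= fine (loss x).
Proof.
move=> Xx /epiE tx; have h : ((- t)%:E <= loss x)%E := le_trans tx (le_loss k x).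
have Dx : loss_dom x.
  by split => // lx; move: h; rewrite lx leeNy_eq.
by split => //; move: h; rewrite {1}(loss_domE Dx) lee_fin.
Qed.

Lemma loss_epi x : loss_dom x ->
  exists k, epi (fun x => - ell k x)%E x (- fine (loss x)).
Proof.
move=> Dx; apply/not_existsP => h.
have /lt_eqF/negbT/eqP : (loss x < (fine (loss x))%:E)%E; last first.
  by rewrite -loss_domE.
apply/bigmax_ltP; split => [|k _]; first exact: ltNyr.
rewrite ltNge; apply/negP => hk; apply: (h k); apply/epiE.
by rewrite opprK.
Qed.

Let cost i x := nrm (x - xh i).

(** If some plan stays in the domain of the loss at a cost below [eps], a Lagrange
    multiplier exists. Otherwise [eps] is at most the average distance [d i] of the
    data points to that domain; plans of cost [eps] can then only move each point
    to a nearest point of the domain, and a large [l] makes the bound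
    [loss <= r i + l (cost - d i)] valid as soon as [r i] exceeds the loss at the
    points of the domain nearest to [xh i]. *)
Lemma robust_bound (eps b delta : R) : loss_dom !=set0 -> 0 < delta ->
  two_plan_bound loss_dom (fun x => fine (loss x)) cost eps b ->
  exists l s, [/\ 0 <= l,
    forall i k x t, Xi x -> epi (fun x => - ell k x)%E x t ->
      - t <= s i + l * nrm (x - xh i) &
    l * eps + avg s <= b + delta].
Proof.
move=> [z Dz] delta0 H.
have [[x0 [Dx0 cx0]]|far] := pselect (exists x0 : 'I_N -> V,
    (forall i, loss_dom (x0 i)) /\ avg (fun i => cost i (x0 i)) < eps).
  have [l [s [l0 hs ls]]] := plan_multiplier hN H Dx0 cx0.
  exists l, s; split => //; last lra.
  by move=> i k x t Xx /(epi_loss Xx)[Dx /le_trans]; apply; exact: hs.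
pose C i := [set cost i x | x in loss_dom].
pose d i := inf (C i).
have hC i : has_inf (C i).
  split; first by exists (cost i z), z.
  by exists 0 => _ [x _ <-]; exact: (nrm_ge0 hnrm).
have d_le i x : loss_dom x -> d i <= cost i x.
  by move=> Dx; apply: ge_inf; [case: (hC i)|exists x].
have eps_d : eps <= avg d.
  apply/ler_addgt0Pr => e e0.
  have /choice[x hx] : forall i, exists x, loss_dom x /\ cost i x < d i + e.
    by move=> i; have [_ [x Dx <-] h] := inf_adherent e0 (hC i); exists x.
  have : eps <= avg (fun i => cost i (x i)).
    rewrite leNgt; apply/negP => h; apply: far; exists x; split => // i.
    by have [] := hx i.
  have : avg (fun i => cost i (x i)) <= avg (fun i => d i + e).
    by apply: ler_avg => i; exact/ltW/(hx i).2.
  by rewrite avgD avg_cst//; lra.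
pose near_dom i := [set x | loss_dom x /\ cost i x <= d i].
have outside (r : 'I_N -> R) :
    (forall i x, near_dom i x -> fine (loss x) < r i) ->
    exists2 l0 : R, 0 <= l0 & forall l, l0 <= l -> forall i k x t, Xi x ->
      epi (fun x => - ell k x)%E x t -> - t <= r i - l * d i + l * nrm (x - xh i).
  move=> hr.
  have /choice[l0 hl0] : forall ik : 'I_N * 'I_K, exists l0 : R, 0 <= l0 /\
      forall l, l0 <= l -> forall x t, Xi x -> epi (fun x => - ell ik.2 x)%E x t ->
      - t <= r ik.1 + l * (nrm (x - xh ik.1) - d ik.1).
    move=> [i k] /=.
    have [||l0 l00 h] := @growth_outside_ball _ _ _ hnrm _ Xi (xh i) (d i) (r i)
      (pf k) (@cf k) (@lf k) cXi.
    - by move=> x t Xx /(epi_loss Xx)[/(d_le i)].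
    - move=> x t Xx xd /(epi_loss Xx)[Dx tx].
      by have := hr i x (conj Dx xd); lra.
    - by exists l0.
  exists (\sum_ik l0 ik) => [|l hl i k x t Xx fxt].
    by apply: sumr_ge0 => ik _; have [] := hl0 ik.
  have le_l : l0 (i, k) <= l.
    rewrite (le_trans _ hl)// (bigD1 (i, k))//= lerDl sumr_ge0// => ik _.
    by have [] := hl0 ik.
  by have := (hl0 (i, k)).2 l le_l x t Xx fxt; rewrite /=; lra.
have /choice[M hM] : forall i, exists M, forall x, near_dom i x -> fine (loss x) <= M.
  move=> i.
  have /choice[aL haL] : forall k, exists aL : R * R, 0 <= aL.2 /\
      forall x t, epi (fun x => - ell k x)%E x t -> aL.1 - aL.2 * cost i x <= t.
    by move=> k; have [a [L h]] := cone_minorant hnrm (xh i) (pf k) (@cf k) (@lf k); exists (a, L).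
  exists (\sum_k ((aL k).2 * `|d i| + `|(aL k).1|)) => x [Dx xd].
  have [k /(haL k).2 h] := loss_epi Dx.
  have : (aL k).2 * `|d i| + `|(aL k).1| <= \sum_k ((aL k).2 * `|d i| + `|(aL k).1|).
    rewrite [leRHS](bigD1 k)//= lerDl sumr_ge0// => j _.
    by rewrite addr_ge0// mulr_ge0//; have [] := haL j.
  have := ler_wpM2l (haL k).1 (le_trans xd (ler_norm (d i))).
  have := ler_norm (- (aL k).1); rewrite normrN; lra.
have obj l (r : 'I_N -> R) :
    l * eps + avg (fun i => r i - l * d i) = avg r - l * (avg d - eps).
  by rewrite avgB avgZ; ring.
(* below the average distance the objective tends to -oo as l grows *)
have [lt_d|] := boolP (eps < avg d).
  have [|l0 l00 hl0] := outside (fun i => M i + 1).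
    by move=> i x /hM; lra.
  pose q := `|avg (fun i => M i + 1) - b| / (avg d - eps).
  have q0 : 0 <= q by rewrite divr_ge0// subr_ge0 ltW.
  exists (l0 + q), (fun i => M i + 1 - (l0 + q) * d i); split.
  - by rewrite addr_ge0.
  - by apply: hl0; rewrite lerDl.
  - rewrite obj mulrDl /q divfK ?gt_eqF ?subr_gt0//.
    have : 0 <= l0 * (avg d - eps) by rewrite mulr_ge0// subr_ge0.
    have := ler_norm (avg (fun i => M i + 1) - b); lra.
rewrite -leNgt => d_eps; have {d_eps}eps_eq : avg d - eps = 0.
  by apply/eqP; rewrite subr_eq0 eq_le d_eps eps_d.
have [[i0 hi0]|near_ex] := pselect (exists i, ~ (near_dom i !=set0)).
  (* no point of the domain is nearest to xh i0, so r i0 may be taken so low that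
     the average of r is b *)
  pose r i := M i + 1 + (if i == i0 then N%:R * (b - avg (fun i => M i + 1)) else 0).
  have [|l0 l00 hl0] := outside r.
    move=> i x; rewrite /r; have [-> nx|_ /hM] := eqVneq i i0; last lra.
    by exfalso; apply: hi0; exists x.
  exists l0, (fun i => r i - l0 * d i); split => //; first exact: hl0.
  rewrite obj eps_eq mulr0 subr0 /r avgD {2}/avg -big_mkcond/= big_pred1_eq mulKf.
    by lra.
  by rewrite pnatr_eq0 -lt0n.
pose S i := [set fine (loss x) | x in near_dom i].
have hS i : has_sup (S i).
  split; last by exists (M i) => _ [x /hM h <-].
  have [x nx] : near_dom i !=set0 by apply/not_notP => h; apply: near_ex; exists i.
  by exists (fine (loss x)), x.
have [|l0 l00 hl0] := outside (fun i => sup (S i) + delta / 2).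
  move=> i x nx; have : fine (loss x) <= sup (S i).
    by apply: sup_upper_bound => //; exists x.
  lra.
exists l0, (fun i => sup (S i) + delta / 2 - l0 * d i); split => //; first exact: hl0.
rewrite obj eps_eq mulr0 subr0 avgD avg_cst//.
have delta20 : 0 < delta / 2 by lra.
have /choice[x hx] : forall i, exists x, near_dom i x /\
    sup (S i) - delta / 2 < fine (loss x).
  by move=> i; have [_ [x nx <-] h] := sup_adherent delta20 (hS i); exists x.
have h1 : avg (fun i => cost i (x i)) <= eps.
  have : avg (fun i => cost i (x i)) <= avg d.
    by apply: ler_avg => i; have [[]] := hx i.
  lra.
have := H x x 1; rewrite subrr !mul0r !addr0 !mul1r.
have Dx i : loss_dom (x i) by have [[]] := hx i.
move=> /(_ Dx Dx); rewrite ler01 lexx => /(_ isT h1) h2.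
have : avg (fun i => sup (S i) - delta / 2) <= avg (fun i => fine (loss (x i))).
  by apply: ler_avg => i; exact/ltW/(hx i).2.
by rewrite avgB avg_cst//; lra.
Qed.

End robust_bound.

(** * Borel measurability and finitely supported distributions *)

Section borel.
Context {R : realType} {m : nat}.
Local Notation V := 'rV[R]_m.

Lemma closed_measurable_rV (A : set V) : closed A -> measurable A.
Proof.
move=> cA; rewrite -(setCK A); apply: measurableC.
by apply: sub_sigma_algebra; exact: closed_openC.
Qed.

Lemma continuous_measurable_rV (f : V -> R) :
  continuous f -> measurable_fun [set: V] f.
Proof.
move=> /continuousP cf; apply: (measurability _ (RGenOpens.measurableE R)).
move=> _ [_ [a [b ->] <-]]; rewrite setTI; apply: sub_sigma_algebra.
exact/cf/interval_open.
Qed.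

Context (nrm : V -> R) (hnrm : is_norm nrm).

Lemma rat_dense_rV (x : V) (e : R) : 0 < e ->
  exists q : 'rV[rat]_m, nrm (x - map_mx ratr q) < e.
Proof.
move=> e0; pose C := \sum_(i < m) nrm (delta_mx ord0 i).
have C0 : 0 <= C by apply: sumr_ge0 => i _; exact: nrm_ge0.
have C10 : 0 < C + 1 by lra.
pose h := e / (C + 1).
have h0 : 0 < h by rewrite divr_gt0.
have /choice[q hq] : forall i, exists q : rat, `|x ord0 i - ratr q| <= h.
  move=> i; have : x ord0 i - h < x ord0 i + h by lra.
  move=> /rat_in_itvoo[q]; rewrite in_itv/= => /andP[q1 q2].
  by exists q; rewrite ler_norml; apply/andP; split; lra.
exists (\row_i q i); apply: (le_lt_trans (nrm_le_coord hnrm _)).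
apply: (@le_lt_trans _ _ (h * C)).
  rewrite mulr_sumr; apply: ler_sum => i _; rewrite !mxE.
  by rewrite ler_wpM2r ?(nrm_ge0 hnrm).
by rewrite /h mulrAC ltr_pdivrMr// ltr_pM2l//; lra.
Qed.

(** A countable dense set of intermediate points writes the sublevel sets of the
    distance as countable unions of rectangles. *)
Lemma measurable_nrm_dist :
  measurable_fun [set: V * V] (fun u => nrm (u.1 - u.2)).
Proof.
have mB (y : V) (a : R) : measurable [set x : V | nrm (x - y) < a].
  have := continuous_measurable_rV (@continuous_nrmB _ _ _ hnrm y).
  move=> /(_ measurableT _ (measurable_itv `]-oo, a[)).
  by rewrite setTI; congr measurable; apply/seteqP; split => x /=; rewrite in_itv.
apply: (measurability _ (RGenInftyO.measurableE R)).
move=> _ [_ [r ->] <-]; rewrite setTI.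
rewrite (_ : _ @^-1` _ = \bigcup_q \bigcup_a
    ([set x : V | nrm (x - map_mx ratr (q : 'rV[rat]_m)) < ratr (a : rat)] `*`
     [set y : V | nrm (y - map_mx ratr q) < r - ratr a])).
  apply: countable_bigcupT_measurable; first exact: countableP.
  by move=> q; apply: bigcupT_measurable_rat => a; exact: measurableX.
apply/seteqP; split => [[x y] /=|[x y] [q _ [a _ [/= xq yq]]]]; rewrite in_itv/=.
- move=> xy; have e0 : 0 < (r - nrm (x - y)) / 2 by lra.
  have [q hq] := rat_dense_rV x e0.
  have [a] : exists a : rat, ratr a \in `]nrm (x - map_mx ratr q),
      (r - nrm (y - map_mx ratr q))[.
    apply: rat_in_itvoo.
    by have := nrm_dist hnrm y x (map_mx ratr q); rewrite (nrmC hnrm y x); lra.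
  rewrite in_itv/= => /andP[a1 a2].
  by exists q => //; exists a => //; split => //=; lra.
- have := nrm_dist hnrm x (map_mx ratr q) y.
  by rewrite (nrmC hnrm (map_mx _ _) y); lra.
Qed.

End borel.

Section two_plan_measure.
Context {d : measure_display} {T : measurableType d} {R : realType} {N : nat}.
Context (hN : (0 < N)%N).
Local Open Scope ereal_scope.

(** [msum] is indexed by natural numbers; [insubd] reads an index below [N] as an
    ordinal. *)
Definition uniform_atoms (a : 'I_N -> T) : {measure set T -> \bar R} :=
  mscale ((N%:R^-1 : R)%:nng)%R (msum (fun j => \d_(a (insubd (Ordinal hN) j))) N).

Lemma integral_uniform_atoms (a : 'I_N -> T) (D : set T) (f : T -> \bar R)
    (g : 'I_N -> R) : measurable D -> measurable_fun D f ->
  (forall x, D x -> 0 <= f x) -> (forall i, D (a i)) ->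
  (forall i, f (a i) = (g i)%:E) ->
  \int[uniform_atoms a]_(x in D) f x = (avg g)%:E.
Proof.
move=> mD mf f0 Da fg; rewrite ge0_integral_mscale// ge0_integral_measure_sum//.
rewrite (eq_bigr (fun i => (g i)%:E)) => [|i _].
  by rewrite sumEFin -EFinM.
by rewrite valKd integral_dirac// diracE mem_set// mul1e fg.
Qed.

Lemma uniform_atomsE (a : 'I_N -> T) (A : set T) :
  uniform_atoms a A = (avg (fun i => \1_A (a i)))%:E.
Proof.
rewrite /uniform_atoms/= /mscale/= /msum/= /avg EFinM -sumEFin; congr (_ * _).
by apply: eq_bigr => i _; rewrite valKd.
Qed.

Variables (p : R) (p01 : (0 <= p <= 1)%R).

Let p0 : (0 <= p)%R. Proof. by case/andP: p01. Qed.
Let p1 : (0 <= 1 - p)%R. Proof. by rewrite subr_ge0; case/andP: p01. Qed.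

Definition two_plan_measure (a b : 'I_N -> T) : set T -> \bar R :=
  measure_add (mscale (NngNum p0) (uniform_atoms a))
              (mscale (NngNum p1) (uniform_atoms b)).

HB.instance Definition _ a b := Measure.on (two_plan_measure a b).

Lemma two_plan_measureE a b A : two_plan_measure a b A =
  (p * avg (fun i => \1_A (a i)) + (1 - p) * avg (fun i => \1_A (b i)))%:E.
Proof.
transitivity (p%:E * uniform_atoms a A + (1 - p)%:E * uniform_atoms b A).
  by rewrite /two_plan_measure measure_addE.
by rewrite !uniform_atomsE -!EFinM -EFinD.
Qed.

Let two_plan_measureT a b : two_plan_measure a b setT = 1.
Proof.
rewrite two_plan_measureE; congr EFin.
have h (c : 'I_N -> T) : avg (fun i => \1_setT (c i)) = 1%R :> R.
  by rewrite -[RHS](avg_cst hN); congr avg; apply/funext => i; rewrite indicT.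
by rewrite !h; ring.
Qed.

HB.instance Definition _ a b :=
  Measure_isProbability.Build _ _ _ (two_plan_measure a b) (two_plan_measureT a b).

Lemma integral_two_plan (a b : 'I_N -> T) (D : set T) (f : T -> \bar R)
    (g h : 'I_N -> R) : measurable D -> measurable_fun D f ->
  (forall x, D x -> 0 <= f x) -> (forall i, D (a i)) -> (forall i, D (b i)) ->
  (forall i, f (a i) = (g i)%:E) -> (forall i, f (b i) = (h i)%:E) ->
  \int[two_plan_measure a b]_(x in D) f x = (p * avg g + (1 - p) * avg h)%:E.
Proof.
move=> mD mf f0 Da Db fg fh; rewrite ge0_integral_measure_add//.
rewrite (ge0_integral_mscale (uniform_atoms a))// (ge0_integral_mscale (uniform_atoms b))//.
rewrite (integral_uniform_atoms mD mf f0 Da fg).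
by rewrite (integral_uniform_atoms mD mf f0 Db fh) EFinD !EFinM.
Qed.

End two_plan_measure.

(** * Expectations over the Wasserstein ball *)

Section wasserstein_duality.
Context {R : realType} {m N K : nat} (hN : (0 < N)%N).
Local Notation V := 'rV[R]_m.
Context (nrm : V -> R) (hnrm : is_norm nrm) (Xi : set V) (xh : 'I_N -> V).
Context (ell : 'I_K -> V -> \bar R).
Hypothesis mell : forall k, measurable_fun [set: V] (ell k).
Hypothesis hxh : forall i, Xi (xh i).
Hypothesis cXi : closed Xi.
Hypothesis pf : forall k, proper_efun (fun x => - ell k x)%E.

Let mXi : measurable Xi. Proof. exact: closed_measurable_rV. Qed.
Let mD : measurable (Xi `*` Xi). Proof. exact: measurableX. Qed.

Let dsubE (a b : R) : (a%:E - b%:E)%dE = (a - b)%:E. Proof. by []. Qed.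

Let maxr_split (r : R) : r = Num.max r 0 - Num.max (- r) 0.
Proof.
have [r0|r0] := leP 0 r; first by rewrite max_r ?subr0// oppr_le0.
by rewrite max_l ?sub0r ?opprK// oppr_ge0 ltW.
Qed.

Lemma measurable_loss : measurable_fun [set: V] (loss ell).
Proof.
rewrite /loss; elim: (index_enum _) => [|k r ih].
  by under eq_fun do rewrite big_nil; exact: measurable_cst.
by under eq_fun do rewrite big_cons; exact: measurable_maxe.
Qed.

Lemma empiricalE (A : set V) : empirical xh A = (avg (fun i => \1_A (xh i)))%:E.
Proof. by rewrite /empirical /avg EFinM -sumEFin. Qed.

Lemma integral_empirical (f : V -> \bar R) (g : 'I_N -> R) :
  measurable_fun [set: V] f -> (forall x, 0 <= f x)%E ->
  (forall i, f (xh i) = (g i)%:E) ->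
  (\int[empirical xh]_x f x = (avg g)%:E)%E.
Proof.
move=> mf f0 fg.
rewrite (@eq_measure_integral _ _ _ setT (uniform_atoms hN xh)).
  exact: integral_uniform_atoms.
by move=> A mA _; rewrite uniform_atomsE; exact: empiricalE.
Qed.

Lemma expectE (Q : probability V R) (f : V -> \bar R) :
  expect Q f = ((\int[Q]_x f^\+ x)%E - (\int[Q]_x f^\- x)%E)%dE.
Proof.
rewrite /expect; congr (_ + _)%dE.
  by apply: eq_integral => x _; rewrite funeposE.
rewrite -integral_ge0N//; apply: eq_integral => x _.
by rewrite funenegE oppe_max oppeK oppe0.
Qed.

(** Moving [xh i] to [x i] with probability [p] and to [y i] otherwise is a coupling
    whose cost is the mixture of the two average costs. *)
Lemma two_plan_in_ball (x y : 'I_N -> V) (p eps : R) (p01 : 0 <= p <= 1) :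
  (forall i, Xi (x i)) -> (forall i, Xi (y i)) ->
  p * avg (fun i => nrm (x i - xh i)) + (1 - p) * avg (fun i => nrm (y i - xh i))
    <= eps ->
  wasserstein_ball nrm Xi (empirical xh) eps (two_plan_measure hN p01 x y).
Proof.
move=> Xx Xy hc; split.
  split.
    rewrite [LHS]two_plan_measureE; congr EFin.
    have h (c : 'I_N -> V) : (forall i, Xi (c i)) -> avg (fun i => \1_Xi (c i)) = 1 :> R.
      move=> Xc; rewrite -[RHS](avg_cst hN); congr avg; apply/funext => i.
      by rewrite indicE mem_set.
    by rewrite !h//; ring.
  rewrite (@integral_two_plan _ _ _ _ _ _ _ _ _ _ _ (fun i => nrm (x i)) (fun i => nrm (y i)))//.
  - exact: ltry.
  - apply/measurable_EFinP; apply: continuous_measurable_rV.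
    exact: continuous_nrm.
  - by move=> z _; rewrite lee_fin (nrm_ge0 hnrm).
pose Pi := two_plan_measure hN p01 (fun i => (xh i, x i)) (fun i => (xh i, y i)).
apply: (@le_trans _ _ (\int[Pi]_(u in Xi `*` Xi) (nrm (u.1 - u.2))%:E)%E); last first.
  rewrite (@integral_two_plan _ _ _ _ _ _ _ _ _ _ _ (fun i => nrm (xh i - x i))
    (fun i => nrm (xh i - y i)))//.
  - rewrite lee_fin (le_trans _ hc)//.
    by under eq_fun do rewrite (nrmC hnrm); under [in X in _ + X]eq_fun do rewrite (nrmC hnrm).
  - by apply/measurable_EFinP/measurable_funTS; exact: measurable_nrm_dist.
  - by move=> z _; rewrite lee_fin (nrm_ge0 hnrm).
  - by move=> i; split => //=.
  - by move=> i; split => //=.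
apply: ereal_inf_lbound; exists Pi => // A mA; split.
- rewrite /pushforward [LHS]two_plan_measureE [RHS]empiricalE; congr EFin.
  by rewrite -[in LHS]mulrDl addrC subrK mul1r.
- by rewrite /pushforward [LHS]two_plan_measureE [RHS]two_plan_measureE.
Qed.

Lemma expect_two_plan (x y : 'I_N -> V) (p : R) (p01 : 0 <= p <= 1) :
  measurable_fun [set: V] (loss ell) ->
  (forall i, loss_dom Xi ell (x i)) -> (forall i, loss_dom Xi ell (y i)) ->
  expect (two_plan_measure hN p01 x y) (loss ell) =
  (p * avg (fun i => fine (loss ell (x i))) +
   (1 - p) * avg (fun i => fine (loss ell (y i))))%:E.
Proof.
move=> ml Dx Dy; pose L z := fine (loss ell z).
rewrite expectE.
have hp z : loss_dom Xi ell z -> ((loss ell)^\+ z = (Num.max (L z) 0)%:E)%E.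
  by move=> Dz; rewrite funeposE (loss_domE pf Dz) EFin_max.
have hn z : loss_dom Xi ell z -> ((loss ell)^\- z = (Num.max (- L z) 0)%:E)%E.
  by move=> Dz; rewrite funenegE (loss_domE pf Dz) EFin_max.
rewrite (@integral_two_plan _ _ _ _ _ _ _ _ _ _ _ (fun i => Num.max (L (x i)) 0)
  (fun i => Num.max (L (y i)) 0))//; last 3 first.
- exact: measurable_funepos.
- by move=> i; exact: hp.
- by move=> i; exact: hp.
rewrite (@integral_two_plan _ _ _ _ _ _ _ _ _ _ _ (fun i => Num.max (- L (x i)) 0)
  (fun i => Num.max (- L (y i)) 0))//; last 3 first.
- exact: measurable_funeneg.
- by move=> i; exact: hn.
- by move=> i; exact: hn.
have split_avg (c : 'I_N -> V) : avg (fun i => L (c i)) =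
    avg (fun i => Num.max (L (c i)) 0) - avg (fun i => Num.max (- L (c i)) 0).
  rewrite -avgB; congr avg; apply/funext => i.
  exact: maxr_split.
rewrite -/(L _) !split_avg dsubE; congr EFin; ring.
Qed.

(** The least [s] for which the robust bound with multiplier [l] holds at a data
    point [x]; as a function of all [x] it is Lipschitz, hence measurable. *)
Definition robust_value (l : R) (x : V) : R :=
  sup [set fine (loss ell z) - l * nrm (z - x) | z in loss_dom Xi ell].

Section robust_value.
Variables (l : R) (s : 'I_N -> R).
Hypothesis l0 : 0 <= l.
Hypothesis dom0 : loss_dom Xi ell !=set0.
Hypothesis hs : forall i k x t, Xi x -> epi (fun x => - ell k x)%E x t ->
  - t <= s i + l * nrm (x - xh i).

Let hs_dom i z : loss_dom Xi ell z -> fine (loss ell z) <= s i + l * nrm (z - xh i).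
Proof.
move=> Dz; have [k /(hs i Dz.1)] := loss_epi pf Dz.
by rewrite opprK.
Qed.

(* the bound at an arbitrary data point and the triangle inequality *)
Let has_sup_value x :
  has_sup [set fine (loss ell z) - l * nrm (z - x) | z in loss_dom Xi ell].
Proof.
have [z0 Dz0] := dom0; pose i0 := Ordinal hN.
split; first by exists (fine (loss ell z0) - l * nrm (z0 - x)), z0.
exists (s i0 + l * nrm (x - xh i0)) => _ [z Dz <-].
have := hs_dom i0 Dz; have := ler_wpM2l l0 (nrm_dist hnrm z x (xh i0)); lra.
Qed.

Lemma robust_value_ub x z : loss_dom Xi ell z ->
  fine (loss ell z) <= robust_value l x + l * nrm (z - x).
Proof.
move=> Dz; rewrite -lerBlDr; apply: sup_upper_bound => //.
by exists z.
Qed.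

Lemma robust_value_xh i : robust_value l (xh i) <= s i.
Proof.
apply: ge_sup; first by case: (has_sup_value (xh i)).
by move=> _ [z Dz <-]; rewrite lerBlDr; exact: hs_dom.
Qed.

Lemma robust_value_lipschitz x y :
  robust_value l x <= robust_value l y + l * nrm (x - y).
Proof.
apply: ge_sup; first by case: (has_sup_value x).
move=> _ [z Dz <-]; have := robust_value_ub y Dz.
have := ler_wpM2l l0 (nrm_dist hnrm z x y); lra.
Qed.

Lemma continuous_robust_value : continuous (robust_value l).
Proof.
have l10 : 0 < l + 1 by rewrite ltr_wpDl.
move=> x; apply/(@cvgrPdist_le R R^o _ (nbhs x)) => /= e e0.
have : nbhs x [set y | nrm (y - x) < e / (l + 1)].
  apply: (@continuous_nrmB _ _ _ hnrm x x [set t | t < e / (l + 1)]).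
  by rewrite subrr (nrm0 hnrm); apply: lt_nbhsl; rewrite divr_gt0.
move=> near_x; apply: filterS near_x => y /=; rewrite ltr_pdivlMr// => yx.
have := robust_value_lipschitz x y; have := robust_value_lipschitz y x.
rewrite (nrmC hnrm x y) ler_norml; have := nrm_ge0 hnrm (y - x).
by move=> *; apply/andP; split; lra.
Qed.

(** Weak duality: along a coupling of the empirical distribution with [Q] the loss
    at the end point is at most [phi], the sum of [robust_value] at the starting
    point and of [l] times the distance. As [phi] is integrable, this bounds the
    positive part of the loss above and its negative part below even when the loss
    is not integrable. *)
Lemma expect_le_robust (Q : probability V R) (eps : R) :
  wasserstein_ball nrm Xi (empirical xh) eps Q ->
  (expect Q (loss ell) <= (l * eps + avg s)%:E)%E.
Proof.
move=> [[QXi _] wQ].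
pose g := robust_value l.
have mg : measurable_fun [set: V] g.
  by apply: continuous_measurable_rV; exact: continuous_robust_value.
apply/lee_addgt0Pr => d d0.
have d10 : 0 < d / (l + 1) by rewrite divr_gt0// ltr_wpDl.
have [_ [Pi hPi <-] cPi] : exists2 c, [set \int[Pi]_(u in Xi `*` Xi)
    (nrm (u.1 - u.2)%R)%:E | Pi in couplings (empirical xh) Q]%E c &
    (c < (eps + d / (l + 1))%:E)%E.
  by apply: ereal_inf_lt; apply: (le_lt_trans wQ); rewrite lte_fin ltrDl.
have PiD : Pi (~` (Xi `*` Xi)) = 0%E.
  have mC : measurable (~` Xi) by exact: measurableC.
  have [P1 P2] := hPi _ mC.
  have Z1 : Pi (fst @^-1` (~` Xi)) = 0%E.
    rewrite -[LHS]/(pushforward Pi fst (~` Xi)) P1 [LHS]empiricalE.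
    rewrite (_ : (fun i => _) = fun=> 0) ?(avg_cst hN)//.
    by apply/funext => i; rewrite indicE memNset// => /(_ (hxh i)).
  have Z2 : Pi (snd @^-1` (~` Xi)) = 0%E.
    rewrite -[LHS]/(pushforward Pi snd (~` Xi)) P2.
    by rewrite -[LHS]/(Q (~` Xi)) probability_setC// QXi subee.
  apply/eqP; rewrite eq_le measure_ge0 andbT.
  apply: (@le_trans _ _ (Pi (fst @^-1` (~` Xi) `|` snd @^-1` (~` Xi)))).
    apply: le_measure; rewrite ?inE.
    - exact: measurableC.
    - apply: measurableU; rewrite -[X in measurable X]setTI.
        exact: measurable_fst.
      exact: measurable_snd.
    - by move=> [x y] /= xy; have [Xx|] := pselect (Xi x); [right => Xy; apply: xy|left].
  apply: (le_trans (measureU2 _ _ _)).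
  - by rewrite -[X in measurable X]setTI; exact: measurable_fst.
  - by rewrite -[X in measurable X]setTI; exact: measurable_snd.
  rewrite -[leRHS]adde0; apply: leeD; rewrite le_eqVlt; apply/orP; left; apply/eqP.
    exact: Z1.
  exact: Z2.
have toD (f : V * V -> \bar R) : measurable_fun setT f -> (forall u, 0 <= f u)%E ->
    (\int[Pi]_u f u = \int[Pi]_(u in Xi `*` Xi) f u)%E.
  move=> mf f0; rewrite (@ge0_negligible_integral _ _ _ _ _ (~` (Xi `*` Xi)))//.
    by rewrite setTD setCK.
  exact: measurableC.
have snd_int (f : V -> \bar R) : measurable_fun setT f -> (forall x, 0 <= f x)%E ->
    (\int[Q]_x f x = \int[Pi]_(u in Xi `*` Xi) f u.2)%E.
  move=> mf f0.
  rewrite (@eq_measure_integral _ _ _ setT (pushforward Pi snd)); last first.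
    by move=> A mA _; have [_ h] := hPi _ mA; exact: esym h.
  rewrite (ge0_integral_pushforward measurable_snd)//.
  rewrite preimage_setT toD//.
    exact: (measurableT_comp mf measurable_snd).
  by move=> u; exact: f0.
have fst_int (f : V -> \bar R) (r : 'I_N -> R) : measurable_fun setT f ->
    (forall x, 0 <= f x)%E -> (forall i, f (xh i) = (r i)%:E) ->
    (\int[Pi]_(u in Xi `*` Xi) f u.1 = (avg r)%:E)%E.
  move=> mf f0 fr; rewrite -(integral_empirical mf f0 fr).
  rewrite -toD; [|exact: (measurableT_comp mf measurable_fst)|by move=> u; exact: f0].
  rewrite (@eq_measure_integral _ _ _ setT (pushforward Pi fst) (empirical xh)).
    by rewrite (ge0_integral_pushforward measurable_fst).
  by move=> A mA _; have [h _] := hPi _ mA; exact: esym h.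
pose c (u : V * V) : R := nrm (u.1 - u.2).
have mc : measurable_fun setT c by exact: measurable_nrm_dist.
have ic : Pi.-integrable (Xi `*` Xi) (EFin \o c).
  apply/integrableP; split.
    by apply/measurable_EFinP; exact: measurable_funTS.
  apply: le_lt_trans (lt_trans cPi (ltry _)).
  apply: ge0_le_integral => //.
  - by apply/measurable_EFinP/measurable_funTS; exact: measurableT_comp.
  - by apply/measurable_EFinP; exact: measurable_funTS.
  - by move=> u _ /=; rewrite lee_fin ger0_norm// nrm_ge0.
have mgE : measurable_fun setT (EFin \o g) by exact/measurable_EFinP.
have mg1 : measurable_fun setT (fun u : V * V => (g u.1)%:E).
  exact: (measurableT_comp mgE measurable_fst).
have ig : Pi.-integrable (Xi `*` Xi) (fun u => (g u.1)%:E).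
  apply/integrableP; split; first exact: measurable_funTS.
  rewrite (fst_int (fun x => `|(g x)%:E|)%E (fun i => `|g (xh i)|)) ?ltry//.
  exact: measurableT_comp.
have int_g : (\int[Pi]_(u in Xi `*` Xi) (g u.1)%:E)%E = (avg (fun i => g (xh i)))%:E.
  have -> : avg (fun i => g (xh i)) = avg (fun i => Num.max (g (xh i)) 0) -
      avg (fun i => Num.max (- g (xh i)) 0).
    by rewrite -avgB; congr avg; apply/funext => i; exact: maxr_split.
  rewrite integralE EFinB; congr (_ - _)%E.
  - rewrite -(fst_int ((EFin \o g)^\+)%E).
    + by apply: eq_integral => u _; rewrite !funeposE.
    + exact: measurable_funepos.
    + by move=> x; exact: funepos_ge0.
    + by move=> i; rewrite funeposE EFin_max.
  - rewrite -(fst_int ((EFin \o g)^\-)%E).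
    + by apply: eq_integral => u _; rewrite !funenegE.
    + exact: measurable_funeneg.
    + by move=> x; exact: funeneg_ge0.
    + by move=> i; rewrite funenegE EFin_max.
pose phi u := ((g u.1)%:E + l%:E * (c u)%:E)%E.
have ilc : Pi.-integrable (Xi `*` Xi) (fun u => l%:E * (c u)%:E)%E.
  exact: integrableZl.
have iphi : Pi.-integrable (Xi `*` Xi) phi by exact: integrableD.
have int_phi : (\int[Pi]_(u in Xi `*` Xi) phi u <= (l * eps + avg s + d)%:E)%E.
  rewrite integralD// int_g integralZl//.
  apply: (@le_trans _ _ ((avg s)%:E + l%:E * (eps + d / (l + 1))%:E)%E).
    apply: leeD; first by rewrite lee_fin; apply: ler_avg => i; exact: robust_value_xh.
    by apply: lee_wpmul2l; [rewrite lee_fin|exact: ltW cPi].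
  rewrite -EFinM -EFinD lee_fin.
  have : l * (d / (l + 1)) <= d.
    by rewrite mulrCA ler_piMr ?(ltW d0)// ler_pdivrMr ?ltr_wpDl// mul1r lerDl.
  lra.
have loss_phi u : (Xi `*` Xi) u -> (loss ell u.2 <= phi u)%E.
  move=> [_ Xu]; have [lN|lN] := pselect (loss ell u.2 = -oo%E).
    by rewrite lN leNye.
  have Du : loss_dom Xi ell u.2 by [].
  rewrite (loss_domE pf Du) /phi -EFinM -EFinD lee_fin /c (nrmC hnrm).
  exact: robust_value_ub.
have ml := measurable_loss.
have ml2 : measurable_fun setT (fun u : V * V => loss ell u.2).
  exact: (measurableT_comp ml measurable_snd).
have mphi : measurable_fun (Xi `*` Xi) phi by case/integrableP : iphi.
rewrite expectE -EFinD; apply: le_trans int_phi.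
rewrite [leRHS]integralE.
have := integrable_pos_fin_num mD iphi.
have := integrable_neg_fin_num mD iphi.
have := snd_int _ (measurable_funepos ml) (funepos_ge0 _).
have := snd_int _ (measurable_funeneg ml) (funeneg_ge0 _).
move=> -> ->.
set A := integral _ _ (phi^\+)%E; set B := integral _ _ (phi^\-)%E.
move=> finB finA.
have -> : (A - B)%E = (A - B)%dE by rewrite -(fineK finA) -(fineK finB).
apply: DualAddTheoryRealDomain.lee_dB; rewrite /A /B.
  apply: ge0_le_integral => //.
  - apply: measurable_funTS; exact: (measurableT_comp (measurable_funepos ml) measurable_snd).
  - exact: measurable_funepos.
  - move=> u Du; rewrite !funeposE ge_max !le_max lexx orbT andbT.
    by rewrite loss_phi.
apply: ge0_le_integral => //.
- exact: measurable_funeneg.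
- apply: measurable_funTS; exact: (measurableT_comp (measurable_funeneg ml) measurable_snd).
- move=> u Du; rewrite !funenegE ge_max !le_max lexx orbT andbT.
  by rewrite leeN2 loss_phi.
Qed.

End robust_value.

End wasserstein_duality.

(** * The convex program *)

Section program.
Context {R : realType} {m N K : nat}.
Local Notation V := 'rV[R]_m.

Let daddE (a b : R) : (a%:E + b%:E)%dE = (a + b)%:E. Proof. by []. Qed.
Let dsubE (a b : R) : (a%:E - b%:E)%dE = (a - b)%:E. Proof. by []. Qed.

Lemma conjugate_ge (f : V -> \bar R) (w x : V) t :
  epi f x t -> ((dot w x - t)%:E <= conjugate f w)%E.
Proof.
move=> fxt; apply: le_trans (ereal_sup_ubound _); last by exists x.
rewrite /epi in fxt; case: (f x) fxt => [r| |]//; last by rewrite leey.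
by rewrite !lee_fin; lra.
Qed.

Lemma support_ge (X : set V) (nu y : V) :
  X y -> ((dot nu y)%:E <= support_function X nu)%E.
Proof. by move=> Xy; apply: ereal_sup_ubound; exists y. Qed.

(** As [X] is nonempty and [f] proper, neither supremum is [-oo], so the extended
    sum is at most [s] exactly when all sums of one term of each are. *)
Lemma constraintP (f : V -> \bar R) (X : set V) (w nu : V) (c s : R) :
  proper_efun f -> X !=set0 ->
  ((conjugate f w + support_function X nu - c%:E <= s%:E)%dE <->
   forall x t y, epi f x t -> X y -> dot w x - t + dot nu y - c <= s).
Proof.
move=> pf [y0 Xy0]; have [x0 [t0 fx0]] := proper_epi pf.
have fxt0 : epi f x0 t0 by rewrite /epi fx0.
split=> [h x t y fxt Xy|h].
  move: h; have := conjugate_ge w fxt; have := support_ge nu Xy.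
  case: (conjugate f w) => [a| |]//; case: (support_function X nu) => [b| |]//.
  by rewrite daddE dsubE !lee_fin; lra.
have conj_le y : X y -> (conjugate f w <= (s + c - dot nu y)%:E)%E.
  move=> Xy; apply: ge_ereal_sup => _ [x _ <-].
  case E : (f x) (pf.2 x) => [t| |]// _; last exact: leNye.
  by have := h x t y; rewrite /epi E lexx => /(_ isT Xy); rewrite dsubE lee_fin; lra.
move: conj_le (conjugate_ge w fxt0).
case: (conjugate f w) => [a| |] // conj_le _; last by have := conj_le _ Xy0.
have : (support_function X nu <= (s + c - a)%:E)%E.
  by apply: ge_ereal_sup => _ [y Xy <-]; have := conj_le y Xy; rewrite !lee_fin; lra.
move: (support_ge nu Xy0); case: (support_function X nu) => [b| |]// _.
by rewrite daddE dsubE !lee_fin; lra.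
Qed.

Context (nrm : V -> R) (hnrm : is_norm nrm) (Xi : set V) (xh : 'I_N -> V).
Context (ell : 'I_K -> V -> \bar R).
Hypothesis Xi0 : Xi !=set0.
Hypothesis pf : forall k, proper_efun (fun x => - ell k x)%E.

Lemma feasibleP (lam : R) (s : 'I_N -> R) (z nu : 'I_N -> 'I_K -> V) :
  feasible nrm Xi xh ell (lam, s, z, nu) <->
  (forall i k x t y, epi (fun x => - ell k x)%E x t -> Xi y ->
     dot (z i k - nu i k) x - t + dot (nu i k) y - dot (z i k) (xh i) <= s i) /\
  (forall i k, 0 <= lam /\ forall v, dot (z i k) v <= lam * nrm v).
Proof.
split=> -[h1 h2]; split=> i k.
- by move: (h1 i k); move/(constraintP _ _ _ _ (pf k) Xi0).
- exact/(dual_normP hnrm)/h2.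
- by apply/(constraintP _ _ _ _ (pf k) Xi0); exact: h1.
- exact/(dual_normP hnrm)/h2.
Qed.

Lemma feasible_convex (p : R) (d d' : decision R m N K) : 0 <= p <= 1 ->
  feasible nrm Xi xh ell d -> feasible nrm Xi xh ell d' ->
  feasible nrm Xi xh ell (p *: d + (1 - p) *: d').
Proof.
move=> p01; have /andP[p0 p1] := p01; rewrite -subr_ge0 in p1.
case: d => [[[l s] z] nu]; case: d' => [[[l' s'] z'] nu'].
move=> /feasibleP[h1 h2] /feasibleP[h1' h2'].
apply/(feasibleP (p * l + (1 - p) * l') (fun i => p * s i + (1 - p) * s' i)
  (fun i k => p *: z i k + (1 - p) *: z' i k)
  (fun i k => p *: nu i k + (1 - p) *: nu' i k)); split.
- move=> i k x t y fxt Xy.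
  have := ler_wpM2l p0 (h1 i k x t y fxt Xy).
  have := ler_wpM2l p1 (h1' i k x t y fxt Xy).
  by rewrite !(dotBl, dotDl, dotZl); lra.
- move=> i k; have [l0 hz] := h2 i k; have [l'0 hz'] := h2' i k.
  split=> [|v]; first by rewrite addr_ge0// mulr_ge0.
  have := ler_wpM2l p0 (hz v); have := ler_wpM2l p1 (hz' v).
  by rewrite dotDl !dotZl; lra.
Qed.

Lemma objective_affine (eps p : R) (d d' : decision R m N K) :
  objective eps (p *: d + (1 - p) *: d') =
  p * objective eps d + (1 - p) * objective eps d'.
Proof.
case: d => [[[l s] z] nu]; case: d' => [[[l' s'] z'] nu'].
rewrite /objective/=.
transitivity ((p * l + (1 - p) * l') * eps +
  N%:R^-1 * \sum_(i < N) (p * s i + (1 - p) * s' i)); first by [].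
by rewrite big_split/= -!mulr_sumr; ring.
Qed.

End program.

Unset Implicit Arguments.
Set Strict Implicit.
Set Printing Implicit Defensive.

Theorem theorem4p2 (R : realType) (m N K : nat) (hN : (0 < N)%N) (hK : (0 < K)%N)
    (nrm : 'rV[R]_m -> R) (hnrm : is_norm nrm)
    (Xi : set 'rV[R]_m) (xihat : 'I_N -> 'rV[R]_m)
    (hxihat : forall i, Xi (xihat i))
    (ell : 'I_K -> 'rV[R]_m -> \bar R)
    (hell_meas : forall k, measurable_fun [set: 'rV[R]_m] (ell k))
    (hXi_convex : convex_set Xi) (hXi_closed : closed Xi)
    (hell_proper : forall k, proper_efun (fun x => - ell k x)%E)
    (hell_convex : forall k, convex_efun (fun x => - ell k x)%E)
    (hell_lsc : forall k, lower_semicontinuous (fun x => - ell k x)%E)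
    (hell_Xi : forall k, exists2 x, Xi x & ell k x <> -oo%E)
    (eps : R) (heps : 0 <= eps) :
  [/\ convex_set (feasible nrm Xi xihat ell),
      convex_function (feasible nrm Xi xihat ell) (objective eps) &
      ereal_sup [set expect Q (fun x => \big[maxe/-oo%E]_(k < K) ell k x)
                | Q in wasserstein_ball nrm Xi (empirical xihat) eps]
      = optimal_value nrm Xi xihat ell eps].
Proof.
have Xi0 : Xi !=set0 by exists (xihat (Ordinal hN)); exact: hxihat.
have num01 (t : {i01 R}) : 0 <= t%:num <= 1 by rewrite ge0 le1.
have cvXi x y p : 0 <= p <= 1 -> Xi x -> Xi y -> Xi (p *: x + (1 - p) *: y).
  move=> p01 Xx Xy; have := hXi_convex x y (Itv01 (andP p01).1 (andP p01).2).
  by rewrite !inE; apply.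
have dom k x : ell k x <> -oo%E -> exists t, epi (fun x => - ell k x)%E x t.
  move=> lN; exists (- fine (ell k x)); apply/epiE; rewrite opprK.
  by case: (ell k x) lN (ell_lty hell_proper k x) => [r| |].
split.
- move=> d d' t; rewrite !inE => fd fd'.
  exact: (feasible_convex hnrm Xi0 hell_proper (num01 t) fd fd').
- by move=> t d d' _ _; rewrite le_eqVlt; apply/orP; left; apply/eqP; exact: objective_affine.
apply/eqP; rewrite eq_le; apply/andP; split.
- apply: ge_ereal_sup => _ [Q ballQ <-].
  apply: le_ereal_inf_tmp => _ [[[[l s] z] nu] fd <-].
  have [h1 h2] := (feasibleP hnrm xihat Xi0 hell_proper l s z nu).1 fd.
  have k0 := Ordinal hK.
  have l0 : 0 <= l by have [] := h2 (Ordinal hN) k0.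
  have [x0 Xx0 lx0] := hell_Xi k0.
  have Dx0 : loss_dom Xi ell !=set0.
    have [t fxt] := dom _ _ lx0; exists x0.
    by have [] := epi_loss hell_proper Xx0 fxt.
  apply: (expect_le_robust hN hnrm hell_meas hxihat hXi_closed hell_proper l0 Dx0 _ ballQ).
  move=> i k x t Xx fxt; have := h1 i k x t x fxt Xx.
  have := (h2 i k).2 (xihat i - x); rewrite (nrmC hnrm) dotBr dotBl; lra.
have sup_ub b : (ereal_sup [set expect Q (fun x => \big[maxe/-oo%E]_(k < K) ell k x)
                | Q in wasserstein_ball nrm Xi (empirical xihat) eps] <= b%:E)%E ->
    (optimal_value nrm Xi xihat ell eps <= b%:E)%E.
  move=> hb; apply/lee_addgt0Pr => e e0.
  have e20 : 0 < e / 2 by rewrite divr_gt0.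
  have [x0 Xx0 lx0] := hell_Xi (Ordinal hK).
  have Dx0 : loss_dom Xi ell !=set0.
    have [t fxt] := dom _ _ lx0; exists x0.
    by have [] := epi_loss hell_proper Xx0 fxt.
  have H : two_plan_bound (loss_dom Xi ell) (fun x => fine (loss ell x))
      (fun i x => nrm (x - xihat i)) eps b.
    move=> x y p Dx Dy p01 hc.
    have ml := measurable_loss hell_meas.
    rewrite -lee_fin -(expect_two_plan hN hell_proper p01 ml Dx Dy).
    apply: le_trans hb; apply: ereal_sup_ubound.
    exists (two_plan_measure hN p01 x y) => //.
    apply: two_plan_in_ball => // i.
      by have [] := Dx i.
    by have [] := Dy i.
  have [l [s [l0 hs obj]]] := robust_bound hN hnrm hXi_closed hell_proper
    hell_convex hell_lsc Dx0 e20 H.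
  (* raising l and every s i by d raises the objective by d * (eps + 1) = e / 2 *)
  pose d := e / 2 / (eps + 1).
  have eps1 : 0 < eps + 1 by lra.
  have d0 : 0 < d by rewrite divr_gt0.
  have /choice[zn hzn] : forall ik : 'I_N * 'I_K, exists zn : 'rV[R]_m * 'rV[R]_m,
      (forall v, dot zn.1 v <= (l + d) * nrm v) /\
      forall x t y, epi (fun x => - ell ik.2 x)%E x t -> Xi y ->
        dot (zn.1 - zn.2) x - t + dot zn.2 y - dot zn.1 (xihat ik.1) <= s ik.1 + d.
    move=> [i k].
    have [|z [nu h]] := dual_certificate hnrm (hell_proper k) (hell_convex k)
      (hell_lsc k) hXi_closed cvXi _ l0 d0 (hs i k).
      have [x Xx lx] := hell_Xi k; have [t fxt] := dom _ _ lx.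
      by exists x, t.
    by exists (z, nu).
  apply: (@le_trans _ _ ((l + d) * eps + avg (fun i => s i + d))%:E).
    apply: ereal_inf_lbound.
    exists (l + d, fun i => s i + d, fun i k => (zn (i, k)).1, fun i k => (zn (i, k)).2) => //.
    apply/(feasibleP hnrm xihat Xi0 hell_proper); split=> i k.
      by move=> x t y; have [_] := hzn (i, k); exact.
    by split; [rewrite addr_ge0// ltW|have [] := hzn (i, k)].
  rewrite -EFinD lee_fin avgD avg_cst//.
  have : d * (eps + 1) = e / 2 by rewrite /d divfK// gt_eqF.
  lra.
move: sup_ub; set S := ereal_sup _; case: S => [r| |] sup_ub; last first.
- case: (optimal_value nrm Xi xihat ell eps) sup_ub => [r| |]// h.
    have /h : (-oo <= (r - 1)%:E)%E by exact: leNye.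
    by rewrite lee_fin lerDl oppr_ge0 ler10.
  have /h : (-oo <= 0%:E :> \bar R)%E by exact: leNye.
  by rewrite leye_eq.
- exact: leey.
- exact: sup_ub.
Qed.
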